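(* Let $f=f(x,y,p)$ and $h=h(x,y)$ be smooth functions, and let $L=2\varrho\frac{\partial^2}{\partial\varrho^2}-3\frac{\partial}{\partial\varrho}-\tfrac18\frac{\partial^2}{\partial p^2}$. Consider the linear system for $A,B,C$, functions of $(x,y,p,\varrho)$: $$\begin{aligned}LA&=\tfrac9{40}f_{pppp},\\ LB&=-\tfrac1{36}A_p+\tfrac3{40}f_{ppp}+\tfrac9{20}h_y,\\ LC&=-\tfrac1{18}B_p+\tfrac1{324}A+\tfrac1{30}f_{pp}-\tfrac2{15}h^2+\tfrac15(ph_y+h_x).\end{aligned}$$ The most general solution to this system, vanishing at $\varrho=0$ and being analytic in $\varrho$ whenever $f$ is analytic, is given by $$\begin{aligned}A&=\frac35\sum_{k=1}^\infty\frac{(2k-1)(2k-3)}{2^{2k}(2k)!}\,\frac{\partial^{2k+2}f}{\partial p^{2k+2}}\,\varrho^k,\\ B&=-\frac3{20}\varrho h_y-\frac1{15}\sum_{k=1}^\infty\frac{(2k-1)(2k-3)(2k-5)}{2^{2k}(2k)!}\,\frac{\partial^{2k+1}f}{\partial p^{2k+1}}\,\varrho^k,\\ C&=\frac2{45}\varrho h^2-\frac1{15}\varrho(ph_y+h_x)+\frac2{135}\sum_{k=1}^\infty\frac{(k-3)(2k-1)(2k-3)(2k-5)}{2^{2k}(2k)!}\,\frac{\partial^{2k}f}{\partial p^{2k}}\,\varrho^k.\end{aligned}$$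
   Context: Subscripts $x,y,p$ denote partial derivatives. Solutions are sought as power series $A=\sum_{k\ge1}a_k(x,y,p)\varrho^k$, $B=\sum_{k\ge1}b_k(x,y,p)\varrho^k$, $C=\sum_{k\ge1}c_k(x,y,p)\varrho^k$ (formal power series for general smooth $f$). *)

(* Defs.v *)
From Stdlib Require Import Reals List Factorial.
From Coquelicot Require Import Coquelicot.
Import ListNotations.
Open Scope R_scope.

(* A scalar coordinate on [T]: how to read it off a point, and how to replace
   it while the other coordinates stay fixed. *)
Record coord (T : Type) := Coord { get : T -> R ; upd : T -> R -> T }.
Arguments Coord {T} get upd.
Arguments get {T} c q.
Arguments upd {T} c q t.

Definition pd {T : Type} (c : coord T) (g : T -> R) (q : T) : R :=
  Derive (fun t => g (upd c q t)) (get c q).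

Fixpoint Cn {T : UniformSpace} (cs : list (coord T)) (n : nat)
    (D : T -> Prop) (g : T -> R) : Prop :=
  (forall q, D q -> continuous g q) /\
  match n with
  | O => True
  | S m => forall c, In c cs ->
      (forall q, D q -> ex_derive (fun t => g (upd c q t)) (get c q)) /\
      Cn cs m D (pd c g)
  end.

Definition smooth {T : UniformSpace} (cs : list (coord T))
    (D : T -> Prop) (g : T -> R) : Prop :=
  forall n, Cn cs n D g.

Definition x2 : coord (R * R) :=
  Coord (fun '(x, _) => x) (fun '(_, y) t => (t, y)).
Definition y2 : coord (R * R) :=
  Coord (fun '(_, y) => y) (fun '(x, _) t => (x, t)).
Definition coords2 : list (coord (R * R)) := [x2; y2].

Definition x3 : coord (R * R * R) :=
  Coord (fun '(x, _, _) => x) (fun '(_, y, p) t => (t, y, p)).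
Definition y3 : coord (R * R * R) :=
  Coord (fun '(_, y, _) => y) (fun '(x, _, p) t => (x, t, p)).
Definition p3 : coord (R * R * R) :=
  Coord (fun '(_, _, p) => p) (fun '(x, y, _) t => (x, y, t)).
Definition coords3 : list (coord (R * R * R)) := [x3; y3; p3].

Definition x4 : coord (R * R * R * R) :=
  Coord (fun '(x, _, _, _) => x) (fun '(_, y, p, rho) t => (t, y, p, rho)).
Definition y4 : coord (R * R * R * R) :=
  Coord (fun '(_, y, _, _) => y) (fun '(x, _, p, rho) t => (x, t, p, rho)).
Definition p4 : coord (R * R * R * R) :=
  Coord (fun '(_, _, p, _) => p) (fun '(x, y, _, rho) t => (x, y, t, rho)).
Definition rho4 : coord (R * R * R * R) :=
  Coord (fun '(_, _, _, rho) => rho) (fun '(x, y, p, _) t => (x, y, p, t)).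
Definition coords4 : list (coord (R * R * R * R)) := [x4; y4; p4; rho4].

(* Real analyticity in [(x, y, p)] at every point of [U]: the Taylor series
   converges absolutely to the function on a polydisc. *)
Definition cube_sum (u : nat -> nat -> nat -> R) (N : nat) : R :=
  sum_n (fun i => sum_n (fun j => sum_n (fun k => u i j k) N) N) N.

Definition analytic (U : R * R * R -> Prop) (f : R * R * R -> R) : Prop :=
  forall x y p, U (x, y, p) ->
  exists (c : nat -> nat -> nat -> R) (r : R), 0 < r /\
  forall s t w, Rabs s < r -> Rabs t < r -> Rabs w < r ->
    (exists M, forall N,
       cube_sum (fun i j k => Rabs (c i j k * s ^ i * t ^ j * w ^ k)) N <= M) /\
    is_lim_seq (cube_sum (fun i j k => c i j k * s ^ i * t ^ j * w ^ k))
      (f (x + s, y + t, p + w)).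

Definition dp (n : nat) (f : R * R * R -> R) : R * R * R -> R :=
  Nat.iter n (pd p3) f.

(* The terms of the three right-hand sides that involve only [f] and [h]. *)
Definition sourceA (f : R * R * R -> R) (q : R * R * R) : R :=
  9 / 40 * dp 4 f q.

Definition sourceB (f : R * R * R -> R) (h : R * R -> R) (q : R * R * R) : R :=
  let '(x, y, p) := q in
  3 / 40 * dp 3 f q + 9 / 20 * pd y2 h (x, y).

Definition sourceC (f : R * R * R -> R) (h : R * R -> R) (q : R * R * R) : R :=
  let '(x, y, p) := q in
  1 / 30 * dp 2 f q - 2 / 15 * h (x, y) ^ 2
  + 1 / 5 * (p * pd y2 h (x, y) + pd x2 h (x, y)).

(* Formal power series in [rho]; [a k] is the coefficient of [rho ^ k]. *)
Definition fps := nat -> R * R * R -> R.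

Definition L_formal (a : fps) : fps := fun n q =>
  2 * PS_incr_1 (PS_derive (PS_derive (fun k => a k q))) n
  - 3 * PS_derive (fun k => a k q) n
  - 1 / 8 * dp 2 (a n) q.

Definition fps_const (g : R * R * R -> R) : fps := fun n q =>
  match n with O => g q | S _ => 0 end.

Definition formal_solution (U : R * R * R -> Prop) (f : R * R * R -> R)
    (h : R * R -> R) (a b c : fps) : Prop :=
  (forall k, smooth coords3 U (a k) /\ smooth coords3 U (b k) /\
             smooth coords3 U (c k)) /\
  (forall q, U q -> a 0%nat q = 0 /\ b 0%nat q = 0 /\ c 0%nat q = 0) /\
  (forall n q, U q ->
     L_formal a n q = fps_const (sourceA f) n q /\
     L_formal b n q =
       - (1 / 36) * dp 1 (a n) q + fps_const (sourceB f h) n q /\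
     L_formal c n q =
       - (1 / 18) * dp 1 (b n) q + 1 / 324 * a n q
       + fps_const (sourceC f h) n q).

(* A point [(x, y, p, rho)] is literally the pair [((x, y, p), rho)], so
   [(q, 0)] with [q] in [U] ranges over the slice [rho = 0]. *)
Definition nbhd_rho0 (U : R * R * R -> Prop) (W : R * R * R * R -> Prop)
  : Prop := open W /\ forall q, U q -> W (q, 0).

Definition near_rho0 (U : R * R * R -> Prop) (P : R * R * R -> R -> Prop)
  : Prop :=
  exists W, nbhd_rho0 U W /\ forall q rho, W (q, rho) -> P q rho.

Definition L_op (F : R * R * R * R -> R) (q : R * R * R) (rho : R) : R :=
  2 * rho * pd rho4 (pd rho4 F) (q, rho) - 3 * pd rho4 F (q, rho)
  - 1 / 8 * pd p4 (pd p4 F) (q, rho).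

Definition rho_series_on (W : R * R * R * R -> Prop) (F : R * R * R * R -> R)
  : Prop :=
  exists a : fps, forall q rho, W (q, rho) ->
    is_pseries (fun k => a k q) rho (F (q, rho)).

Definition analytic_solution (U : R * R * R -> Prop) (f : R * R * R -> R)
    (h : R * R -> R) (A B C : R * R * R * R -> R) : Prop :=
  exists W, nbhd_rho0 U W /\
  (smooth coords4 W A /\ smooth coords4 W B /\ smooth coords4 W C) /\
  (rho_series_on W A /\ rho_series_on W B /\ rho_series_on W C) /\
  (forall q, U q -> A (q, 0) = 0 /\ B (q, 0) = 0 /\ C (q, 0) = 0) /\
  (forall q rho, W (q, rho) ->
     L_op A q rho = sourceA f q /\
     L_op B q rho = - (1 / 36) * pd p4 A (q, rho) + sourceB f h q /\
     L_op C q rho =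
       - (1 / 18) * pd p4 B (q, rho) + 1 / 324 * A (q, rho)
       + sourceC f h q).

(* [g * rho], and [sum_(k >= 1) u k * rho ^ k]. *)
Definition fps_rho (g : R * R * R -> R) : fps := fun n q =>
  match n with 1%nat => g q | _ => 0 end.

Definition fps_from1 (u : fps) : fps := fun n q =>
  match n with O => 0 | S _ => u n q end.

Definition denom (k : nat) : R := 2 ^ (2 * k) * INR (fact (2 * k)).

Definition solA (f : R * R * R -> R) : fps := fun n q =>
  3 / 5 * fps_from1 (fun k q =>
    (2 * INR k - 1) * (2 * INR k - 3) / denom k * dp (2 * k + 2) f q) n q.

Definition solB (f : R * R * R -> R) (h : R * R -> R) : fps := fun n q =>
  - (3 / 20) * fps_rho (fun '(x, y, _) => pd y2 h (x, y)) n q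
  - 1 / 15 * fps_from1 (fun k q =>
    (2 * INR k - 1) * (2 * INR k - 3) * (2 * INR k - 5) / denom k
      * dp (2 * k + 1) f q) n q.

Definition solC (f : R * R * R -> R) (h : R * R -> R) : fps := fun n q =>
  2 / 45 * fps_rho (fun '(x, y, _) => h (x, y) ^ 2) n q
  - 1 / 15 * fps_rho (fun '(x, y, p) =>
      p * pd y2 h (x, y) + pd x2 h (x, y)) n q
  + 2 / 135 * fps_from1 (fun k q =>
    (INR k - 3) * (2 * INR k - 1) * (2 * INR k - 3) * (2 * INR k - 5)
      / denom k * dp (2 * k) f q) n q.

(* Main.v *)
Require Import Defs.
From Stdlib Require Import Reals List Lra Lia Factorial Psatz FunctionalExtensionality.
From Coquelicot Require Import Coquelicot.
Import ListNotations.
Open Scope R_scope.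

(** Comparing coefficients of [rho^n] turns the system into recurrences whose
leading coefficient [(n + 1) (2 n - 3)] never vanishes: hence there is exactly
one formal solution, and the stated coefficients satisfy the recurrences.  For
analytic [f], Cauchy bounds on the derivatives make the coefficient of [rho^k],
which is of order [f^(2k+e) / (2k)!], grow at most geometrically together with
all its derivatives, so the series may be differentiated termwise and its sum
is smooth and solves the system.  Conversely, the Taylor coefficients at
[rho = 0] of an analytic solution form a formal solution, because the partial
derivatives in [p] and [rho] commute. *)

(** * Partial derivatives and smooth functions *)

(** The indicial equation of $L$ at $\varrho=0$ is $r(2r-5)=0$. Its second root $5/2$ is not an
    integer, so asking for power series in $\varrho$ is what excludes the other family of
    homogeneous solutions. On the analytic side the obstacle is that smoothness of a sum concerns
    all iterated partial derivatives, so the domain of convergence must not shrink at each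
    differentiation. All estimates therefore keep one geometric rate and let a differentiation cost
    only a polynomial factor in $k$: a derivative of order $l$ of the $k$-th coefficient is
    controlled by $Q^{2k+l+e}(2k+l+e)!/(2k)!$, which is a polynomial in $k$ times $(Q^2)^k$. The
    factorial bound is obtained with real majorants: the Taylor coefficients of an $l$-th derivative
    are compared with those of the $l$-th derivative of $M/(1-Pz)$. The rate depends on the base
    point, and one tube need not serve all of $U$. The neighbourhood of $\varrho=0$ is a union of
    tubes; smoothness is checked point by point and so passes to the union. *)

Record lawful {T : UniformSpace} (c : coord T) : Prop := {
  upd_get : forall q, upd c q (get c q) = q;
  get_upd : forall q t, get c (upd c q t) = t;
  upd_upd : forall q s t, upd c (upd c q s) t = upd c q t;
  upd_cont : forall q, filterlim (upd c q) (locally (get c q)) (locally q) }.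

Definition lawful_list {T : UniformSpace} (cs : list (coord T)) : Prop :=
  forall c, In c cs -> lawful c.

Lemma lawful_coords3 : lawful_list coords3.
Proof.
  intros c [<-|[<-|[<-|[]]]]; split; try (intros [[x y] p]; reflexivity);
    intros [[x y] p] P [e He]; exists e; intros t Ht; apply He; repeat split;
    try apply ball_center; exact Ht.
Qed.

Lemma lawful_coords4 : lawful_list coords4.
Proof.
  intros c [<-|[<-|[<-|[<-|[]]]]]; split;
    try (intros [[[x y] p] r]; reflexivity);
    intros [[[x y] p] r] P [e He]; exists e; intros t Ht; apply He;
    repeat split; try apply ball_center; exact Ht.
Qed.

Section Calculus.
Context {T : UniformSpace}.
Implicit Types (c : coord T) (cs : list (coord T)) (D : T -> Prop)
  (g : T -> R) (q : T).

(** This is the use of [upd_cont]: an open set of points becomes a neighbourhood of the parameter on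
    a coordinate line, where one-variable calculus applies. *)
Lemma locally_line c D q : lawful c -> open D -> D q ->
  locally (get c q) (fun t => D (upd c q t)).
Proof. intros H HD Hq. apply (upd_cont c H q). apply HD, Hq. Qed.

Lemma pd_ext c g1 g2 q : (forall z, g1 z = g2 z) -> pd c g1 q = pd c g2 q.
Proof. intros H. apply Derive_ext. intros t. apply H. Qed.

Lemma pd_ext_on c D g1 g2 q : lawful c -> open D ->
  (forall z, D z -> g1 z = g2 z) -> D q -> pd c g1 q = pd c g2 q.
Proof.
  intros Hc HD H Hq. apply Derive_ext_loc.
  generalize (locally_line c D q Hc HD Hq). apply filter_imp. auto.
Qed.

(** A coordinate line does not depend on which of its points is the base. This and [pd_line] move
    facts recorded at a point to an arbitrary parameter of the line. *)
Lemma ex_derive_line c g q t : lawful c ->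
  ex_derive (fun s => g (upd c (upd c q t) s)) (get c (upd c q t)) ->
  ex_derive (fun s => g (upd c q s)) t.
Proof.
  intros H. rewrite (get_upd c H). apply ex_derive_ext.
  intros s. now rewrite (upd_upd c H).
Qed.

Lemma pd_line c g q t : lawful c ->
  pd c g (upd c q t) = Derive (fun s => g (upd c q s)) t.
Proof.
  intros H. unfold pd. rewrite (get_upd c H). apply Derive_ext.
  intros s. now rewrite (upd_upd c H).
Qed.

(** A partial derivative at a point of the open set [D] sees only nearby values, so agreement on [D]
    passes to the partial derivatives on [D] and the induction closes. *)
Lemma Cn_ext cs n D g1 g2 : lawful_list cs -> open D ->
  (forall z, D z -> g1 z = g2 z) -> Cn cs n D g1 -> Cn cs n D g2.
Proof.
  intros Hcs HD; revert g1 g2; induction n as [|n IH]; intros g1 g2 H [H0 H1];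
    (split; [intros q Hq; apply continuous_ext_loc with g1;
      [apply filter_imp with D; auto|auto]|]); [exact I|].
  intros c Hc. destruct (H1 c Hc) as [Hd HC]. split.
  - intros q Hq. apply ex_derive_ext_loc with (fun t => g1 (upd c q t)); auto.
    generalize (locally_line c D q (Hcs c Hc) HD Hq). apply filter_imp. auto.
  - apply IH with (pd c g1); [|exact HC].
    intros z Hz. apply pd_ext_on with D; auto.
Qed.

Lemma Cn_sub cs n D1 D2 g : (forall z, D2 z -> D1 z) ->
  Cn cs n D1 g -> Cn cs n D2 g.
Proof.
  intros H; revert g; induction n as [|n IH]; intros g [H0 H1]; split; auto.
  intros c Hc. destruct (H1 c Hc) as [Hd HC]. split; auto.
Qed.

(** The functions differentiated do not depend on [D], which only says where regularity is asserted.
    Hence local results glue without any uniformity in [i]. *)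
Lemma Cn_union {I : Type} cs n (D : I -> T -> Prop) g :
  (forall i, Cn cs n (D i) g) -> Cn cs n (fun z => exists i, D i z) g.
Proof.
  revert g; induction n as [|n IH]; intros g H; split; auto.
  - intros q [i Hi]. now apply (H i).
  - intros q [i Hi]. now apply (H i).
  - intros c Hc. split.
    + intros q [i Hi]. now apply (proj2 (H i) c Hc).
    + apply IH. intros i. now apply (proj2 (H i) c Hc).
Qed.

(** Serves the product rule, in which an undifferentiated factor of order [S n] is needed at order
    [n]. *)
Lemma Cn_pred cs n D g : Cn cs (S n) D g -> Cn cs n D g.
Proof.
  revert g; induction n as [|n IH]; intros g [H0 H1]; split; auto.
  intros c Hc. destruct (H1 c Hc) as [Hd HC]. split; auto.
Qed.

Lemma smooth_continuous cs D g q : smooth cs D g -> D q -> continuous g q.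
Proof. intros H. apply (H 0%nat). Qed.

Lemma smooth_pd cs D g c : In c cs -> smooth cs D g -> smooth cs D (pd c g).
Proof. intros Hc H n. now apply (H (S n)). Qed.

Lemma smooth_ex_derive cs D g c q : In c cs -> smooth cs D g -> D q ->
  ex_derive (fun t => g (upd c q t)) (get c q).
Proof. intros Hc H. now apply (H 1%nat). Qed.

Lemma smooth_ext cs D g1 g2 : lawful_list cs -> open D ->
  (forall z, D z -> g1 z = g2 z) -> smooth cs D g1 -> smooth cs D g2.
Proof. intros Hcs HD H Hg n. apply Cn_ext with g1; auto. Qed.

Lemma smooth_sub cs D1 D2 g : (forall z, D2 z -> D1 z) ->
  smooth cs D1 g -> smooth cs D2 g.
Proof. intros H Hg n. now apply Cn_sub with D1. Qed.

Lemma Cn_const cs n D (k : R) : Cn cs n D (fun _ => k).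
Proof.
  revert k. induction n as [|n IH]; intros k; split; auto;
    try (intros; apply continuous_const).
  intros c Hc. split; [intros; apply ex_derive_const|].
  replace (pd c (fun _ => k)) with (fun _ : T => 0); [apply IH|].
  unfold pd. apply functional_extensionality.
  intros q. symmetry. apply Derive_const.
Qed.

Lemma Cn_plus cs n D g1 g2 : lawful_list cs -> open D ->
  Cn cs n D g1 -> Cn cs n D g2 -> Cn cs n D (fun q => g1 q + g2 q).
Proof.
  intros Hcs HD. revert g1 g2. induction n as [|n IH]; intros g1 g2 [H0 H1] [K0 K1];
   split; auto; try (intros q Hq; apply (continuous_plus g1 g2 q); auto).
  intros c Hc. destruct (H1 c Hc) as [Hd HC]. destruct (K1 c Hc) as [Kd KC].
  split.
  - intros q Hq. apply (ex_derive_plus (fun t => g1 (upd c q t)) (fun t => g2 (upd c q t))); auto.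
  - apply Cn_ext with (fun q => pd c g1 q + pd c g2 q); auto.
    intros z Hz. symmetry. unfold pd. apply Derive_plus; auto.
Qed.

Lemma Cn_mult cs n D g1 g2 : lawful_list cs -> open D ->
  Cn cs n D g1 -> Cn cs n D g2 -> Cn cs n D (fun q => g1 q * g2 q).
Proof.
  intros Hcs HD. revert g1 g2. induction n as [|n IH]; intros g1 g2 H K;
   pose proof H as [H0 H1]; pose proof K as [K0 K1];
   split; auto; try (intros q Hq; apply (continuous_mult g1 g2 q); auto).
  intros c Hc. destruct (H1 c Hc) as [Hd HC]. destruct (K1 c Hc) as [Kd KC].
  split.
  - intros q Hq. apply (ex_derive_mult (fun t => g1 (upd c q t)) (fun t => g2 (upd c q t))); auto.
  - apply Cn_ext with (fun q => pd c g1 q * g2 q + g1 q * pd c g2 q); auto.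
    + intros z Hz. unfold pd. rewrite Derive_mult; auto.
      rewrite !(upd_get c (Hcs c Hc)). reflexivity.
    + apply Cn_plus; auto; apply IH; auto; now apply Cn_pred.
Qed.

Lemma smooth_const cs D (k : R) : smooth cs D (fun _ => k).
Proof. intros n. apply Cn_const. Qed.

Lemma smooth_plus cs D g1 g2 : lawful_list cs -> open D ->
  smooth cs D g1 -> smooth cs D g2 -> smooth cs D (fun q => g1 q + g2 q).
Proof. intros Hcs HD H1 H2 n. now apply Cn_plus. Qed.

Lemma smooth_mult cs D g1 g2 : lawful_list cs -> open D ->
  smooth cs D g1 -> smooth cs D g2 -> smooth cs D (fun q => g1 q * g2 q).
Proof. intros Hcs HD H1 H2 n. now apply Cn_mult. Qed.

(** Mixed derivative along a word of coordinates, the last letter acting first. Keeping the order of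
    the letters allows bounds on all mixed derivatives without permuting partial derivatives. *)
Definition dw (w : list (coord T)) g : T -> R := fold_right pd g w.

Lemma dw_app w1 w2 g : dw (w1 ++ w2) g = dw w1 (dw w2 g).
Proof. apply fold_right_app. Qed.

Lemma smooth_dw cs D g w : incl w cs -> smooth cs D g -> smooth cs D (dw w g).
Proof.
  intros Hw Hg. induction w as [|c w IH]; [exact Hg|].
  apply smooth_pd; [apply Hw; now left|]. apply IH.
  intros d Hd. apply Hw. now right.
Qed.

Lemma dw_ext_on cs w D g1 g2 q : lawful_list cs -> incl w cs -> open D ->
  (forall z, D z -> g1 z = g2 z) -> D q -> dw w g1 q = dw w g2 q.
Proof.
  intros Hcs Hw HD H. revert q. induction w as [|c w IH]; intros q Hq; [auto|].
  apply pd_ext_on with D; auto.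
  - apply Hcs, Hw. now left.
  - apply IH. intros d Hd. apply Hw. now right.
Qed.

(** [Derive] is a total operator that commutes with scalars at every point. With the factor 0 this
    also shows that every [dw] of the zero function vanishes. *)
Lemma dw_scal w (k : R) g q : dw w (fun z => k * g z) q = k * dw w g q.
Proof.
  revert q. induction w as [|c w IH]; intros q; [reflexivity|].
  simpl. etransitivity; [apply pd_ext, IH|]. apply Derive_scal.
Qed.

Lemma dw_plus cs w D g1 g2 q : lawful_list cs -> incl w cs -> open D ->
  smooth cs D g1 -> smooth cs D g2 -> D q ->
  dw w (fun z => g1 z + g2 z) q = dw w g1 q + dw w g2 q.
Proof.
  intros Hcs Hw HD H1 H2. revert q.
  induction w as [|c w IH]; intros q Hq; [auto|].
  assert (Hc : In c cs) by (apply Hw; now left).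
  assert (Hw' : incl w cs) by (intros d Hd; apply Hw; now right).
  simpl. rewrite (pd_ext_on c D _ (fun z => dw w g1 z + dw w g2 z)); auto.
  apply Derive_plus; apply smooth_ex_derive with cs D; auto;
    now apply smooth_dw.
Qed.

End Calculus.

(** * The formal system *)

Lemma in_p3 : In p3 coords3.
Proof. simpl; auto. Qed.

Lemma dp_dw m g : dp m g = dw (repeat p3 m) g.
Proof. induction m as [|m IH]; [reflexivity|]. simpl. now rewrite <- IH. Qed.

Lemma incl_repeat_p3 m : incl (repeat p3 m) coords3.
Proof. intros c Hc. apply repeat_spec in Hc as ->. exact in_p3. Qed.

Lemma dp_add m n g : dp m (dp n g) = dp (m + n) g.
Proof. unfold dp. now rewrite Nat.iter_add. Qed.

Lemma dp_ext m g1 g2 q : (forall z, g1 z = g2 z) -> dp m g1 q = dp m g2 q.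
Proof.
  intros H. f_equal. f_equal.
  now apply functional_extensionality.
Qed.

Lemma dp_ext_on m D g1 g2 q : open D ->
  (forall z, D z -> g1 z = g2 z) -> D q -> dp m g1 q = dp m g2 q.
Proof.
  intros HD H Hq. rewrite !dp_dw. apply (dw_ext_on coords3) with D; auto.
  - exact lawful_coords3.
  - apply incl_repeat_p3.
Qed.

Lemma smooth_dp m D g : smooth coords3 D g -> smooth coords3 D (dp m g).
Proof. intros H. rewrite dp_dw. apply smooth_dw; auto. apply incl_repeat_p3. Qed.

Lemma dp_scal m k g q : dp m (fun z => k * g z) q = k * dp m g q.
Proof. rewrite !dp_dw. apply dw_scal. Qed.

Lemma dp_plus m D g1 g2 q : open D ->
  smooth coords3 D g1 -> smooth coords3 D g2 -> D q ->
  dp m (fun z => g1 z + g2 z) q = dp m g1 q + dp m g2 q.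
Proof.
  intros. rewrite !dp_dw. apply (dw_plus coords3) with D; auto.
  - exact lawful_coords3.
  - apply incl_repeat_p3.
Qed.

Lemma dp_const m (k : R) q : dp (S m) (fun _ => k) q = 0.
Proof.
  revert q. induction m as [|m IH]; intros q; [exact (Derive_const k _)|].
  change (pd p3 (dp (S m) (fun _ => k)) q = 0).
  etransitivity; [apply pd_ext, IH|]. exact (Derive_const 0 _).
Qed.

(** Explains why [h_y] and [h ^ 2] affect only the coefficient of $\varrho$: $L$ passes a
    coefficient on to the next one through $\partial_p^2$, which kills functions of $(x,y)$. *)
Lemma dp_lift m (g : R * R -> R) q : dp (S m) (fun z => g (fst z)) q = 0.
Proof.
  revert q. induction m as [|m IH]; intros [[x y] p].
  - exact (Derive_const (g (x, y)) p).
  - change (pd p3 (dp (S m) (fun z => g (fst z))) (x, y, p) = 0).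
    etransitivity; [apply pd_ext, IH|]. exact (Derive_const 0 _).
Qed.

Lemma Cn_lift n (V : R * R -> Prop) (U : R * R * R -> Prop) g :
  (forall q, U q -> V (fst q)) ->
  Cn coords2 n V g -> Cn coords3 n U (fun q => g (fst q)).
Proof.
  intros HUV. revert g. induction n as [|n IH]; intros g [H0 H1];
   (split; [intros q Hq; apply (continuous_comp fst g);
     [destruct q; apply continuous_fst|auto]|]); [exact I|].
  intros c [<-|[<-|[<-|[]]]].
  - destruct (H1 x2) as [Hd HC]; [simpl; auto|]. split.
    + intros [[x y] p] Hq. apply (Hd (x, y)). now apply (HUV (x, y, p)).
    + replace (pd x3 _) with (fun q : R * R * R => pd x2 g (fst q)).
      * now apply IH.
      * apply functional_extensionality.
        intros [[x y] p]. reflexivity.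
  - destruct (H1 y2) as [Hd HC]; [simpl; auto|]. split.
    + intros [[x y] p] Hq. apply (Hd (x, y)). now apply (HUV (x, y, p)).
    + replace (pd y3 _) with (fun q : R * R * R => pd y2 g (fst q)).
      * now apply IH.
      * apply functional_extensionality.
        intros [[x y] p]. reflexivity.
  - split.
    + intros [[x y] p] Hq. exact (ex_derive_const (g (x, y)) p).
    + replace (pd p3 _) with (fun q : R * R * R => 0); [apply Cn_const|].
      apply functional_extensionality.
      intros q. symmetry. exact (dp_lift 0 g q).
Qed.

Lemma smooth_p3 U : smooth coords3 U (get p3).
Proof.
  assert (Hc : forall q, U q -> continuous (get p3) q).
  { intros [[x y] p] _. apply (continuous_ext snd); [now intros [[]]|].
    apply continuous_snd. }
  intros [|n]; (split; [exact Hc|]); [exact I|].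
  intros c [<-|[<-|[<-|[]]]].
  - split; [intros [[x y] p] _; exact (ex_derive_const p x)|].
    replace (pd x3 _) with (fun q : R * R * R => 0); [apply Cn_const|].
    apply functional_extensionality.
    intros [[x y] p]. symmetry. exact (Derive_const p x).
  - split; [intros [[x y] p] _; exact (ex_derive_const p y)|].
    replace (pd y3 _) with (fun q : R * R * R => 0); [apply Cn_const|].
    apply functional_extensionality.
    intros [[x y] p]. symmetry. exact (Derive_const p y).
  - split; [intros [[x y] p] _; exact (ex_derive_id p)|].
    replace (pd p3 _) with (fun q : R * R * R => 1); [apply Cn_const|].
    apply functional_extensionality.
    intros [[x y] p]. symmetry. exact (Derive_id p).
Qed.

(** Both $2\varrho\partial_\varrho^2$ and $-3\partial_\varrho$ act on the coefficient of index
    $n+1$, with factors $2n(n+1)$ and $-3(n+1)$. At $n=0$ the shift [PS_incr_1] supplies the value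
    0. *)
Lemma L_formal_rec a n q : L_formal a n q =
  (INR n + 1) * (2 * INR n - 3) * a (S n) q - 1 / 8 * dp 2 (a n) q.
Proof.
  unfold L_formal, PS_incr_1, PS_derive. destruct n as [|n].
  - change zero with 0. simpl. ring.
  - rewrite !S_INR. ring.
Qed.

(** The integer $2n-3$ is odd, hence nonzero; equivalently, the indicial root $5/2$ is never equal
    to $n+1$. *)
Lemma leading_coef_neq_0 n : (INR n + 1) * (2 * INR n - 3) <> 0.
Proof.
  apply Rmult_integral_contrapositive. split.
  - pose proof (pos_INR n). lra.
  - rewrite !INR_IZR_INZ, <- mult_IZR, <- minus_IZR. apply not_0_IZR. lia.
Qed.

Lemma denom_pos n : 0 < denom n.
Proof.
  apply Rmult_lt_0_compat; [apply pow_lt; lra|apply INR_fact_lt_0].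
Qed.

(** The factor $8(n+1)$ is the one in the recurrence $(n+1)(2n-3)a_{n+1}=\frac18\partial_p^2a_n$,
    and $2n+1$ cancels against the new linear factor in the numerators. *)
Lemma denom_S n :
  denom (S n) = 8 * (2 * INR n + 1) * (INR n + 1) * denom n.
Proof.
  unfold denom. replace (2 * S n)%nat with (S (S (2 * n))) by lia.
  rewrite !fact_simpl, !mult_INR, !S_INR, mult_INR. simpl. ring.
Qed.

Section Formal.
Variables (U : R * R * R -> Prop) (V : R * R -> Prop)
  (f : R * R * R -> R) (h : R * R -> R).
Hypotheses (hU : open U)
  (hUV : forall x y p, U (x, y, p) -> V (x, y))
  (hf : smooth coords3 U f) (hh : smooth coords2 V h).

(** The coefficients built from [h], written with projections instead of pattern matching so that
    [smooth_lift] and the rules for sums and products apply. *)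
Definition h_y (q : R * R * R) : R := pd y2 h (fst q).
Definition h_sq (q : R * R * R) : R := h (fst q) ^ 2.
Definition h_tr (q : R * R * R) : R :=
  get p3 q * pd y2 h (fst q) + pd x2 h (fst q).

Lemma smooth_lift g : smooth coords2 V g -> smooth coords3 U (fun q => g (fst q)).
Proof.
  intros H n. apply Cn_lift with V; auto.
  intros [[x y] p]. apply hUV.
Qed.

Lemma smooth_h_y : smooth coords3 U h_y.
Proof. apply smooth_lift, smooth_pd; simpl; auto. Qed.

Lemma smooth_h_sq : smooth coords3 U h_sq.
Proof.
  apply smooth_ext with (fun q => h (fst q) * h (fst q)); auto.
  - exact lawful_coords3.
  - intros z _. unfold h_sq. symmetry. rewrite <- Rsqr_pow2. reflexivity.
  - apply smooth_mult; auto; try exact lawful_coords3; now apply smooth_lift.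
Qed.

Lemma smooth_h_tr : smooth coords3 U h_tr.
Proof.
  apply smooth_plus; auto; try exact lawful_coords3.
  - apply smooth_mult; auto; try exact lawful_coords3.
    + apply smooth_p3.
    + exact smooth_h_y.
  - apply smooth_lift, smooth_pd; simpl; auto.
Qed.

Definition cA (k : nat) : R := (2 * INR k - 1) * (2 * INR k - 3) / denom k.
Definition cB (k : nat) : R :=
  (2 * INR k - 1) * (2 * INR k - 3) * (2 * INR k - 5) / denom k.
Definition cC (k : nat) : R :=
  (INR k - 3) * (2 * INR k - 1) * (2 * INR k - 3) * (2 * INR k - 5) / denom k.

(** The index 0 is separated because [cA], [cB] and [cC] do not vanish there, while the solution
    vanishes at $\varrho=0$. *)
Definition fpart (u : nat -> R) (e k : nat) (q : R * R * R) : R :=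
  match k with O => 0 | S _ => u k * dp (2 * k + e) f q end.

Lemma solA_eq n q : solA f n q = 3 / 5 * fpart cA 2 n q.
Proof. destruct n; reflexivity. Qed.

Lemma solB_eq n q :
  solB f h n q = - (3 / 20) * fps_rho h_y n q + - (1 / 15) * fpart cB 1 n q.
Proof.
  destruct q as [[x y] p]. destruct n as [|[|n]];
    unfold solB, fps_from1, fpart, fps_rho, h_y, cB; cbn [fst]; ring.
Qed.

Lemma solC_eq n q : solC f h n q =
  2 / 45 * fps_rho h_sq n q
  + (- (1 / 15) * fps_rho h_tr n q + 2 / 135 * fpart cC 0 n q).
Proof.
  destruct q as [[x y] p].
  destruct n as [|[|n]];
    unfold solC, fps_from1, fpart, fps_rho, h_sq, h_tr, cC;
    rewrite ?Nat.add_0_r; cbn [fst get p3]; ring.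
Qed.

Lemma smooth_scal (k : R) g :
  smooth coords3 U g -> smooth coords3 U (fun q => k * g q).
Proof.
  intros H. apply smooth_mult; auto; try exact lawful_coords3.
  apply smooth_const.
Qed.

Lemma smooth_fpart u e n : smooth coords3 U (fpart u e n).
Proof.
  destruct n as [|n]; [exact (smooth_const _ _ 0)|].
  apply smooth_scal. now apply smooth_dp.
Qed.

Lemma smooth_fps_rho g n : smooth coords3 U g -> smooth coords3 U (fps_rho g n).
Proof. intros H. destruct n as [|[|n]]; auto; exact (smooth_const _ _ 0). Qed.

Lemma smooth_solA n : smooth coords3 U (solA f n).
Proof.
  apply smooth_ext with (fun q => 3 / 5 * fpart cA 2 n q); auto.
  - exact lawful_coords3.
  - apply smooth_scal, smooth_fpart.
Qed.

Lemma smooth_solB n : smooth coords3 U (solB f h n).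
Proof.
  eapply smooth_ext; [exact lawful_coords3|exact hU| |].
  - intros z _. symmetry. apply solB_eq.
  - apply smooth_plus; auto; try exact lawful_coords3; apply smooth_scal.
    + apply smooth_fps_rho, smooth_h_y.
    + apply smooth_fpart.
Qed.

Lemma smooth_solC n : smooth coords3 U (solC f h n).
Proof.
  eapply smooth_ext; [exact lawful_coords3|exact hU| |].
  - intros z _. symmetry. apply solC_eq.
  - apply smooth_plus; auto; try exact lawful_coords3;
      [|apply smooth_plus; auto; try exact lawful_coords3]; apply smooth_scal.
    + apply smooth_fps_rho, smooth_h_sq.
    + apply smooth_fps_rho, smooth_h_tr.
    + apply smooth_fpart.
Qed.

Lemma dp_fpart m u e n q :
  dp (S m) (fpart u e n) q = match n with O => 0
    | S _ => u n * dp (S m + (2 * n + e)) f q end.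
Proof.
  destruct n as [|n]; [exact (dp_const m 0 q)|].
  unfold fpart. rewrite dp_scal. now rewrite dp_add.
Qed.

Lemma dp_fps_rho m g n q : (forall z, U z -> dp (S m) g z = 0) -> U q ->
  dp (S m) (fps_rho g n) q = 0.
Proof.
  intros H Hq. destruct n as [|[|n]]; [exact (dp_const m 0 q)|now apply H|].
  exact (dp_const m 0 q).
Qed.

(** This coefficient is affine in $p$: its first derivative is [h_y], constant along the $p$-line.
    The value 0 is rewritten as the derivative of that constant. *)
Lemma dp_h_tr q : U q -> dp 2 h_tr q = 0.
Proof.
  intros Hq. rewrite <- (dp_const 0 (pd y2 h (fst q)) q).
  change (pd p3 (dp 1 h_tr) q = pd p3 (fun _ => pd y2 h (fst q)) q).
  destruct q as [[x y] p]. apply Derive_ext. intros t.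
  apply is_derive_unique.
  change (is_derive (fun s => s * pd y2 h (x, y) + pd x2 h (x, y)) t
    (pd y2 h (x, y))).
  auto_derive; [exact I|ring].
Qed.

Lemma dp_solA n q : U q -> dp 1 (solA f n) q = 3 / 5 * dp 1 (fpart cA 2 n) q
  /\ dp 2 (solA f n) q = 3 / 5 * dp 2 (fpart cA 2 n) q.
Proof.
  intros Hq. split; rewrite <- dp_scal; apply dp_ext; intros z; apply solA_eq.
Qed.

Lemma dp_solB m n q : U q ->
  dp (S m) (solB f h n) q = - (1 / 15) * dp (S m) (fpart cB 1 n) q.
Proof.
  intros Hq. rewrite (dp_ext _ _ _ _ (solB_eq n)).
  rewrite (dp_plus _ U); auto.
  - rewrite !dp_scal, dp_fps_rho; auto; [ring|].
    intros z _. apply dp_lift.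
  - apply smooth_scal, smooth_fps_rho, smooth_h_y.
  - apply smooth_scal, smooth_fpart.
Qed.

Lemma dp_solC n q : U q ->
  dp 2 (solC f h n) q = 2 / 135 * dp 2 (fpart cC 0 n) q.
Proof.
  intros Hq. rewrite (dp_ext _ _ _ _ (solC_eq n)).
  assert (S1 := smooth_scal (2 / 45) _ (smooth_fps_rho _ n smooth_h_sq)).
  assert (S2 := smooth_scal (- (1 / 15)) _ (smooth_fps_rho _ n smooth_h_tr)).
  assert (S3 := smooth_scal (2 / 135) _ (smooth_fpart cC 0 n)).
  rewrite (dp_plus _ U), (dp_plus _ U); auto.
  - rewrite !dp_scal, !dp_fps_rho; auto; [ring|apply dp_h_tr|].
    intros z _. exact (dp_lift 1 (fun v => h v ^ 2) z).
  - apply smooth_plus; auto. exact lawful_coords3.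
Qed.

(** Once [denom_S] has removed the later factorial, the recurrence is an identity between rational
    functions of the index, over denominators that are visibly positive. *)
Ltac coef_identity n :=
  rewrite denom_S; pose proof (denom_pos (S n)); pose proof (pos_INR (S n));
  field; repeat split; lra.

(** At $n=0$ the recurrence reads $-3a_1=\frac9{40}f_{pppp}$ and fixes the constant $3/5$. For
    $n\ge1$ it is homogeneous, and the ratio of consecutive [cA] is $1/(8(n+1)(2n-3))$ after
    cancelling $2n-1$. *)
Lemma solA_rec n q : U q -> L_formal (solA f) n q = fps_const (sourceA f) n q.
Proof.
  intros Hq. rewrite L_formal_rec, (proj2 (dp_solA n q Hq)), dp_fpart, solA_eq.
  unfold fpart. destruct n as [|n].
  - unfold cA, denom, fps_const, sourceA. simpl. field.
  - replace (2 * S (S n) + 2)%nat with (2 + (2 * S n + 2))%nat by lia.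
    unfold cA, fps_const. rewrite (S_INR (S n)). coef_identity n.
Qed.

(** The extra factor $2k-5$ of [cB] increases by 2 when $k$ does; this increment, times the common
    factor $(2n-1)(2n-3)$, produces the term $A_p$. *)
Lemma solB_rec n q : U q -> L_formal (solB f h) n q =
  - (1 / 36) * dp 1 (solA f n) q + fps_const (sourceB f h) n q.
Proof.
  intros Hq.
  rewrite L_formal_rec, dp_solB, (proj1 (dp_solA n q Hq)), !dp_fpart, solB_eq
    by exact Hq.
  unfold fpart. destruct n as [|n].
  - unfold cB, denom, fps_const, sourceB. destruct q as [[x y] p].
    unfold fps_rho, h_y. simpl. field.
  - replace (2 * S (S n) + 1)%nat with (3 + 2 * S n)%nat by lia.
    replace (2 + (2 * S n + 1))%nat with (3 + 2 * S n)%nat by lia.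
    replace (1 + (2 * S n + 2))%nat with (3 + 2 * S n)%nat by lia.
    unfold cA, cB, fps_const, fps_rho. rewrite (S_INR (S n)). coef_identity n.
Qed.

(** Here the extra factor is $(k-3)(2k-5)$, with increment $4n-9=2(2n-5)+1$ from $k=n$ to $k=n+1$.
    The summand $2(2n-5)$ yields $B_p$ and the summand 1 yields $A$. *)
Lemma solC_rec n q : U q -> L_formal (solC f h) n q =
  - (1 / 18) * dp 1 (solB f h n) q + 1 / 324 * solA f n q
  + fps_const (sourceC f h) n q.
Proof.
  intros Hq.
  rewrite L_formal_rec, dp_solC, dp_solB, !dp_fpart, solA_eq, solC_eq
    by exact Hq.
  unfold fpart. destruct n as [|n].
  - unfold cC, denom, fps_const, sourceC. destruct q as [[x y] p].
    unfold fps_rho, h_sq, h_tr. simpl. field.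
  - replace (2 * S (S n) + 0)%nat with (2 + 2 * S n)%nat by lia.
    replace (2 + (2 * S n + 0))%nat with (2 + 2 * S n)%nat by lia.
    replace (1 + (2 * S n + 1))%nat with (2 + 2 * S n)%nat by lia.
    replace (2 * S n + 2)%nat with (2 + 2 * S n)%nat by lia.
    unfold cA, cB, cC, fps_const, fps_rho. rewrite (S_INR (S n)).
    coef_identity n.
Qed.

Theorem formal_solution_iff (a b c : fps) :
  formal_solution U f h a b c <->
  (forall k q, U q ->
     a k q = solA f k q /\ b k q = solB f h k q /\ c k q = solC f h k q).
Proof.
  split.
  - intros [_ [H0 H]] k. induction k as [|k IH]; intros q Hq.
    + destruct (H0 q Hq) as [-> [-> ->]].
      rewrite solA_eq, solB_eq, solC_eq. unfold fps_rho, fpart.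
      repeat split; ring.
    + destruct (H k q Hq) as [HA [HB HC]].
      rewrite L_formal_rec in HA, HB, HC.
      pose proof (solA_rec k q Hq) as SA.
      pose proof (solB_rec k q Hq) as SB.
      pose proof (solC_rec k q Hq) as SC.
      rewrite L_formal_rec in SA, SB, SC.
      (* The induction hypothesis gives equality on the whole open set [U], so the $p$-derivatives
         of the $k$-th coefficients agree too. *)
      assert (EA : forall m, dp m (a k) q = dp m (solA f k) q)
        by (intros m; apply dp_ext_on with U; auto; intros; now apply IH).
      assert (EB : forall m, dp m (b k) q = dp m (solB f h k) q)
        by (intros m; apply dp_ext_on with U; auto; intros; now apply IH).
      assert (EC : forall m, dp m (c k) q = dp m (solC f h k) q)
        by (intros m; apply dp_ext_on with U; auto; intros; now apply IH).
      rewrite EA in HA, HB. rewrite EB in HB, HC.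
      rewrite EC, (proj1 (IH q Hq)) in HC.
      pose proof (leading_coef_neq_0 k) as Hk.
      repeat split; apply Rmult_eq_reg_l with (2 := Hk); lra.
  - intros H. split; [|split].
    + intros k.
      split; [|split]; (eapply smooth_ext;
        [exact lawful_coords3|exact hU|intros z Hz; symmetry; now apply H|]).
      * apply smooth_solA.
      * apply smooth_solB.
      * apply smooth_solC.
    + intros q Hq. destruct (H 0%nat q Hq) as [-> [-> ->]].
      rewrite solA_eq, solB_eq, solC_eq. unfold fps_rho, fpart.
      repeat split; ring.
    + intros n q Hq. rewrite !L_formal_rec.
      assert (EA : forall m, dp m (a n) q = dp m (solA f n) q)
        by (intros m; apply dp_ext_on with U; auto; intros; now apply H).
      assert (EB : forall m, dp m (b n) q = dp m (solB f h n) q)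
        by (intros m; apply dp_ext_on with U; auto; intros; now apply H).
      assert (EC : forall m, dp m (c n) q = dp m (solC f h n) q)
        by (intros m; apply dp_ext_on with U; auto; intros; now apply H).
      rewrite !EA, !EB, !EC.
      destruct (H (S n) q Hq) as [-> [-> ->]].
      rewrite (proj1 (H n q Hq)), <- !L_formal_rec.
      repeat split; [now apply solA_rec|now apply solB_rec|now apply solC_rec].
Qed.

End Formal.

(** * Dominated series and derivative bounds for analytic functions *)

Lemma ex_series_dominated (v b : nat -> R) :
  (forall k, Rabs (v k) <= b k) -> ex_series b ->
  ex_series (fun k => Rabs (v k)).
Proof.
  intros H Hb. apply (ex_series_le (K := R_AbsRing) (V := R_CompleteNormedModule))
    with b; auto.
  intros n. change norm with Rabs. simpl. rewrite Rabs_Rabsolu. apply H.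
Qed.

Lemma Series_dominated (v b : nat -> R) :
  (forall k, Rabs (v k) <= b k) -> ex_series b -> Rabs (Series v) <= Series b.
Proof.
  intros H Hb. eapply Rle_trans.
  - apply Series_Rabs. now apply ex_series_dominated with b.
  - apply Series_le; [|exact Hb]. intros n. split; [apply Rabs_pos|apply H].
Qed.

Lemma Series_tail_dominated (v b : nat -> R) N :
  (forall k, Rabs (v k) <= b k) -> ex_series b ->
  Rabs (Series v - sum_n v N) <= Series b - sum_n b N.
Proof.
  intros H Hb.
  assert (Hv : ex_series v)
    by (apply ex_series_Rabs; now apply ex_series_dominated with b).
  rewrite (Series_incr_n v (S N)), (Series_incr_n b (S N)), !sum_n_Reals
    by (auto; lia). cbn [Nat.pred].
  replace (_ + _ - _) with (Series (fun k => v (S N + k)%nat)) by ring.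
  replace (_ + _ - _) with (Series (fun k => b (S N + k)%nat)) by ring.
  apply Series_dominated; [intros k; apply H|].
  now apply ex_series_incr_n.
Qed.

Lemma filterlim_sum_n {T : Type} (F : (T -> Prop) -> Prop) {FF : Filter F}
    (u : nat -> T -> R) (l : nat -> R) N :
  (forall k, filterlim (u k) F (locally (l k))) ->
  filterlim (fun x => sum_n (fun k => u k x) N) F (locally (sum_n l N)).
Proof.
  intros H. induction N as [|N IH].
  - rewrite sum_O. apply filterlim_ext with (u 0%nat); auto.
    intros x. now rewrite sum_O.
  - rewrite sum_Sn.
    apply filterlim_ext with (fun x => plus (sum_n (fun k => u k x) N) (u (S N) x)).
    + intros x. now rewrite sum_Sn.
    + eapply filterlim_comp_2; [exact IH|apply H|].
      apply (filterlim_plus (sum_n l N) (l (S N))).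
Qed.

(* Tannery's theorem. *)
Lemma filterlim_Series {T : Type} (F : (T -> Prop) -> Prop) {FF : ProperFilter F}
    (u : nat -> T -> R) (l b : nat -> R) :
  (forall k, filterlim (u k) F (locally (l k))) ->
  F (fun x => forall k, Rabs (u k x) <= b k) -> ex_series b ->
  filterlim (fun x => Series (fun k => u k x)) F (locally (Series l)).
Proof.
  intros Hl Hdom Hb.
  (* The bound survives the limit, so the limit series is dominated by the same [b]. *)
  assert (Hlb : forall k, Rabs (l k) <= b k).
  { intros k.
    apply (filterlim_le (F := F) (fun x => Rabs (u k x)) (fun _ => b k)
      (Rabs (l k)) (b k)).
    - generalize Hdom. apply filter_imp. auto.
    - eapply filterlim_comp; [apply Hl|].
      apply (continuous_Rabs (l k)).
    - apply filterlim_const. }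
  apply filterlim_locally. intros eps.
  (* Three errors of at most [eps / 4]: the two tails, both below the tail of [b], and the
     difference of the finite sums. *)
  assert (He : 0 < eps / 4) by (pose proof (cond_pos eps); lra).
  assert (HN : exists N, Series b - sum_n b N < eps / 4).
  { pose proof (Series_correct b Hb) as HS.
    destruct (proj1 (filterlim_locally _ _) HS (mkposreal _ He)) as [N HN].
    exists N. specialize (HN N (Nat.le_refl N)).
    change (Rabs (sum_n b N - Series b) < eps / 4) in HN.
    apply Rabs_def2 in HN. lra. }
  destruct HN as [N HN].
  pose proof (proj1 (filterlim_locally _ _) (filterlim_sum_n F u l N Hl)
    (mkposreal _ He)) as Hsum.
  generalize (filter_and _ _ Hdom Hsum). apply filter_imp. intros x [Hx Hs].
  pose proof (Series_tail_dominated (fun k => u k x) b N Hx Hb) as H1.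
  pose proof (Series_tail_dominated l b N Hlb Hb) as H2.
  change (Rabs (sum_n (fun k => u k x) N - sum_n l N) < eps / 4) in Hs.
  apply Rabs_def2 in Hs.
  apply Rabs_le_between in H1. apply Rabs_le_between in H2.
  change (Rabs (Series (fun k => u k x) - Series l) < eps).
  apply Rabs_def1; lra.
Qed.

(** Presents a finite sum as a series with zero tail, which brings sums with a moving upper limit
    under [filterlim_Series]. *)
Lemma is_series_truncated (v : nat -> R) N :
  is_series (fun k => if (k <=? N)%nat then v k else 0) (sum_n v N).
Proof.
  apply (filterlim_ext_loc (fun _ => sum_n v N)); [|apply filterlim_const].
  exists N. intros n Hn. induction Hn as [|n Hn IH].
  - apply sum_n_ext_loc. intros k Hk. now rewrite (proj2 (Nat.leb_le k N)).
  - rewrite sum_Sn, <- IH. rewrite (proj2 (Nat.leb_gt (S n) N)) by lia.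
    symmetry. apply Rplus_0_r.
Qed.

(** Summand and upper limit move together with [N]. Extended by zero beyond [N], each term is still
    eventually [v N k], and Tannery's theorem applies along [eventually]. *)
Lemma is_lim_seq_diagonal_sum (v : nat -> nat -> R) (l b : nat -> R) :
  (forall k, is_lim_seq (fun N => v N k) (l k)) ->
  (forall N k, Rabs (v N k) <= b k) -> ex_series b ->
  is_lim_seq (fun N => sum_n (v N) N) (Series l).
Proof.
  intros Hl Hdom Hb.
  apply is_lim_seq_ext with
    (fun N => Series (fun k => if (k <=? N)%nat then v N k else 0)).
  - intros N. apply is_series_unique, is_series_truncated.
  - apply (filterlim_Series eventually
      (fun k N => if (k <=? N)%nat then v N k else 0) l b).
    + intros k. apply (filterlim_ext_loc (fun N => v N k)); [|apply Hl].
      exists k. intros N HN. now rewrite (proj2 (Nat.leb_le k N)).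
    + apply filter_forall. intros N k. destruct (k <=? N)%nat; auto.
      rewrite Rabs_R0. eapply Rle_trans; [apply Rabs_pos|apply (Hdom N k)].
    + exact Hb.
Qed.

Lemma ex_series_geom_scal A t : 0 <= t < 1 -> ex_series (fun k => A * t ^ k).
Proof.
  intros Ht. apply (ex_series_scal_l A (fun k => t ^ k)). apply ex_series_geom.
  rewrite Rabs_pos_eq; lra.
Qed.

Lemma Series_geom_bound (v : nat -> R) A t : 0 <= t < 1 ->
  (forall k, Rabs (v k) <= A * t ^ k) -> Rabs (Series v) <= A / (1 - t).
Proof.
  intros Ht H. eapply Rle_trans.
  - apply Series_dominated with (1 := H). now apply ex_series_geom_scal.
  - rewrite Series_scal_l, Series_geom by (rewrite Rabs_pos_eq; lra).
    apply Rle_refl.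
Qed.

Lemma sum_n_geom_bound (v : nat -> R) A t N : 0 <= t < 1 ->
  (forall k, Rabs (v k) <= A * t ^ k) -> Rabs (sum_n v N) <= A / (1 - t).
Proof.
  intros Ht H. rewrite <- (is_series_unique _ _ (is_series_truncated v N)).
  apply Series_geom_bound; auto. intros k. destruct (k <=? N)%nat; auto.
  rewrite Rabs_R0. eapply Rle_trans; [apply Rabs_pos|apply (H k)].
Qed.

(** The three cutoffs grow simultaneously, so the passage to nested series takes one index at a
    time; each summed index costs a factor $1/(1-t)$ in the dominating sequence. *)
Lemma is_lim_seq_cube_sum (u : nat -> nat -> nat -> R) M t : 0 <= t < 1 ->
  (forall i j k, Rabs (u i j k) <= M * t ^ i * t ^ j * t ^ k) ->
  is_lim_seq (cube_sum u)
    (Series (fun i => Series (fun j => Series (fun k => u i j k)))).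
Proof.
  intros Ht H.
  set (A := / (1 - t)).
  apply (is_lim_seq_diagonal_sum
    (fun N i => sum_n (fun j => sum_n (fun k => u i j k) N) N) _
    (fun i => (M * A * A) * t ^ i)); [| |now apply ex_series_geom_scal].
  - intros i.
    apply (is_lim_seq_diagonal_sum
      (fun N j => sum_n (fun k => u i j k) N) _
      (fun j => (M * t ^ i * A) * t ^ j)); [| |now apply ex_series_geom_scal].
    + intros j.
      apply (is_lim_seq_diagonal_sum (fun N k => u i j k) _
        (fun k => (M * t ^ i * t ^ j) * t ^ k));
        [| |now apply ex_series_geom_scal].
      * intros k. apply is_lim_seq_const.
      * intros _ k. apply H.
    + intros N j. replace (M * t ^ i * A * t ^ j) with
        (M * t ^ i * t ^ j / (1 - t)) by (unfold A, Rdiv; ring).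
      apply sum_n_geom_bound; auto.
  - intros N i. replace (M * A * A * t ^ i) with
      (M * t ^ i * A / (1 - t)) by (unfold A, Rdiv; ring).
    apply sum_n_geom_bound; auto. intros j.
    replace (M * t ^ i * A * t ^ j) with
      (M * t ^ i * t ^ j / (1 - t)) by (unfold A, Rdiv; ring).
    apply sum_n_geom_bound; auto.
Qed.

(** The first conjunct retains the geometric decay in [i]; it later gives the radius of convergence
    in the first variable. *)
Lemma nested_Series_bound (u : nat -> nat -> nat -> R) M t : 0 <= t < 1 ->
  (forall i j k, Rabs (u i j k) <= M * t ^ i * t ^ j * t ^ k) ->
  (forall i, Rabs (Series (fun j => Series (fun k => u i j k))) <=
     (M / (1 - t) / (1 - t)) * t ^ i) /\
  Rabs (Series (fun i => Series (fun j => Series (fun k => u i j k)))) <=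
    M / (1 - t) / (1 - t) / (1 - t).
Proof.
  intros Ht H.
  assert (H1 : forall i, Rabs (Series (fun j => Series (fun k => u i j k))) <=
     (M / (1 - t) / (1 - t)) * t ^ i).
  { intros i. replace (_ * t ^ i) with ((M * t ^ i / (1 - t)) / (1 - t))
      by (unfold Rdiv; ring).
    apply Series_geom_bound; auto. intros j.
    replace (_ * t ^ j) with (M * t ^ i * t ^ j / (1 - t))
      by (unfold Rdiv; ring).
    apply Series_geom_bound; auto. }
  split; [exact H1|]. now apply Series_geom_bound.
Qed.

(** This is $\binom{n+l}{n}\le2^{n+l}$, proved by Pascal's recursion in the form
    $(m+1)!=(n+1)\,m!+(l+1)\,m!$ when $m+1=(n+1)+(l+1)$. *)
Lemma fact_plus_le n l :
  (fact (n + l) <= fact n * fact l * 2 ^ (n + l))%nat.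
Proof.
  remember (n + l)%nat as m eqn:Hm. revert n l Hm.
  induction m as [|m IH]; intros n l Hm.
  - destruct n; destruct l; simpl; lia.
  - destruct n as [|n].
    + simpl in Hm. subst l. pose proof (Nat.pow_nonzero 2 (S m)).
      assert (fact 0 = 1)%nat as -> by reflexivity. nia.
    + destruct l as [|l].
      * rewrite Nat.add_0_r in Hm. rewrite Hm. pose proof (Nat.pow_nonzero 2 (S n)).
        assert (fact 0 = 1)%nat as -> by reflexivity. nia.
      * pose proof (IH n (S l) ltac:(lia)) as H1.
        pose proof (IH (S n) l ltac:(lia)) as H2.
        rewrite (fact_simpl m), (fact_simpl n), (fact_simpl l), Nat.pow_succ_r'.
        rewrite (fact_simpl l) in H1. rewrite (fact_simpl n) in H2.
        replace (S m) with (S n + S l)%nat by lia. nia.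
Qed.

(** * Cauchy estimates for triple power series *)

Definition expands (sigma : R) (c : nat -> nat -> nat -> R)
    (G : R -> R -> R -> R) : Prop :=
  forall s t w, Rabs s < sigma -> Rabs t < sigma -> Rabs w < sigma ->
  is_lim_seq (cube_sum (fun i j k => c i j k * s ^ i * t ^ j * w ^ k)) (G s t w).

(** With $n=i+j+k$ the right-hand side is the coefficient of $z^n$ in the $l$-th derivative of
    $M/(1-Pz)$. A partial derivative raises [l] by one and leaves [M] and [P] unchanged. *)
Definition coef_bound (M P : R) (l : nat) (c : nat -> nat -> nat -> R) : Prop :=
  forall i j k, Rabs (c i j k) <=
    M * (INR (fact (i + j + k + l)) / INR (fact (i + j + k)))
      * P ^ (i + j + k + l).

Lemma expands_ext sigma c G1 G2 :
  (forall s t w, Rabs s < sigma -> Rabs t < sigma -> Rabs w < sigma ->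
    G1 s t w = G2 s t w) -> expands sigma c G1 -> expands sigma c G2.
Proof.
  intros H HG s t w Hs Ht Hw. rewrite <- H by auto. now apply HG.
Qed.

Lemma expands_swap12 sigma c G : expands sigma c G ->
  expands sigma (fun i j k => c j i k) (fun s t w => G t s w).
Proof.
  intros H s t w Hs Ht Hw.
  apply is_lim_seq_ext with (2 := H t s w Ht Hs Hw).
  intros N. unfold cube_sum. rewrite sum_n_switch.
  apply sum_n_ext; intros i. apply sum_n_ext; intros j.
  apply sum_n_ext; intros k.
  match goal with |- ?a = ?b => change (a = b :> R) end. ring.
Qed.

Lemma expands_swap23 sigma c G : expands sigma c G ->
  expands sigma (fun i j k => c i k j) (fun s t w => G s w t).
Proof.
  intros H s t w Hs Ht Hw.
  apply is_lim_seq_ext with (2 := H s w t Hs Hw Ht).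
  intros N. unfold cube_sum. apply sum_n_ext; intros i. rewrite sum_n_switch.
  apply sum_n_ext; intros j. apply sum_n_ext; intros k.
  match goal with |- ?a = ?b => change (a = b :> R) end. ring.
Qed.

Lemma coef_bound_swap12 M P l c : coef_bound M P l c ->
  coef_bound M P l (fun i j k => c j i k).
Proof. intros H i j k. rewrite (Nat.add_comm i j). apply H. Qed.

Lemma coef_bound_swap23 M P l c : coef_bound M P l c ->
  coef_bound M P l (fun i j k => c i k j).
Proof.
  intros H i j k. replace (i + j + k)%nat with (i + k + j)%nat by lia. apply H.
Qed.

Section Cauchy.
Variables (M P sigma : R).
Hypotheses (HM : 0 <= M) (HP : 0 < P) (Hsigma : 4 * P * sigma <= 1).

(** By [fact_plus_le], $(n+l)!/n!\le l!\,2^{n+l}$, which turns $P$ into $2P$. The condition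
    $4P\sigma\le1$ then makes the ratio in each variable at most $1/2$. *)
Lemma coef_bound_term l c i j k : coef_bound M P l c ->
  Rabs (c i j k) <= M * INR (fact l) * (2 * P) ^ l
    * (2 * P) ^ i * (2 * P) ^ j * (2 * P) ^ k.
Proof.
  intros H. eapply Rle_trans; [apply H|]. set (n := (i + j + k)%nat).
  pose proof (INR_fact_lt_0 n) as Hn.
  assert (Hf : INR (fact (n + l)) / INR (fact n) <= INR (fact l) * 2 ^ (n + l)).
  { apply Rmult_le_reg_l with (INR (fact n)); [exact Hn|].
    pose proof (le_INR _ _ (fact_plus_le n l)) as Hle.
    rewrite !mult_INR, pow_INR in Hle. simpl (INR 2) in Hle.
    replace (1 + 1) with 2 in Hle by ring. field_simplify; lra. }
  replace (M * INR (fact l) * (2 * P) ^ l * (2 * P) ^ i * (2 * P) ^ j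
    * (2 * P) ^ k) with (M * (INR (fact l) * 2 ^ (n + l)) * P ^ (n + l)).
  - apply Rmult_le_compat_r; [apply pow_le; lra|].
    apply Rmult_le_compat_l; [exact HM|exact Hf].
  - unfold n. rewrite !Rpow_mult_distr, !pow_add. ring.
Qed.

Lemma scaled_pow_bound s n : Rabs s < sigma -> (2 * P) ^ n * Rabs s ^ n <= (1 / 2) ^ n.
Proof.
  intros Hs. rewrite <- Rpow_mult_distr. apply pow_incr. split.
  - apply Rmult_le_pos; [lra|apply Rabs_pos].
  - pose proof (Rabs_pos s). nra.
Qed.

Lemma term_bound l c s t w i j k : coef_bound M P l c ->
  Rabs s < sigma -> Rabs t < sigma -> Rabs w < sigma ->
  Rabs (c i j k * s ^ i * t ^ j * w ^ k) <=
    M * INR (fact l) * (2 * P) ^ l * (1 / 2) ^ i * (1 / 2) ^ j * (1 / 2) ^ k.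
Proof.
  intros H Hs Ht Hw. rewrite !Rabs_mult, <- !RPow_abs.
  set (A := M * INR (fact l) * (2 * P) ^ l).
  assert (HA : 0 <= A).
  { unfold A. apply Rmult_le_pos; [apply Rmult_le_pos; [lra|apply pos_INR]|].
    apply pow_le. lra. }
  pose proof (coef_bound_term l c i j k H) as Hc. fold A in Hc.
  assert (Hp : forall z n, 0 <= Rabs z ^ n)
    by (intros; apply pow_le, Rabs_pos).
  apply Rle_trans with (A * ((2 * P) ^ i * Rabs s ^ i)
    * ((2 * P) ^ j * Rabs t ^ j) * ((2 * P) ^ k * Rabs w ^ k)).
  - replace (A * ((2 * P) ^ i * Rabs s ^ i) * ((2 * P) ^ j * Rabs t ^ j)
      * ((2 * P) ^ k * Rabs w ^ k)) with
      (A * (2 * P) ^ i * (2 * P) ^ j * (2 * P) ^ k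
       * Rabs s ^ i * Rabs t ^ j * Rabs w ^ k) by ring.
    repeat (apply Rmult_le_compat_r; [apply Hp|]). exact Hc.
  - assert (Hq : forall z n, 0 <= (2 * P) ^ n * Rabs z ^ n).
    { intros. apply Rmult_le_pos; [apply pow_le; lra|apply Hp]. }
    assert (Hh : forall n, 0 <= (1 / 2) ^ n) by (intros; apply pow_le; lra).
    repeat (apply Rmult_le_compat; auto using scaled_pow_bound, Rle_refl,
      Rmult_le_pos).
Qed.

Lemma expands_Series l c G s t w : coef_bound M P l c -> expands sigma c G ->
  Rabs s < sigma -> Rabs t < sigma -> Rabs w < sigma ->
  G s t w = Series (fun i => Series (fun j => Series (fun k =>
    c i j k * s ^ i * t ^ j * w ^ k))).
Proof.
  intros Hc HG Hs Ht Hw.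
  assert (HL := HG s t w Hs Ht Hw). apply is_lim_seq_unique in HL.
  assert (HL' := is_lim_seq_cube_sum
    (fun i j k => c i j k * s ^ i * t ^ j * w ^ k) _ (1 / 2) ltac:(lra)
    (fun i j k => term_bound l c s t w i j k Hc Hs Ht Hw)).
  apply is_lim_seq_unique in HL'. rewrite HL in HL'. now injection HL'.
Qed.

(** The factor 8 is the product of three geometric sums of ratio $1/2$. *)
Lemma expands_bound l c G s t w : coef_bound M P l c -> expands sigma c G ->
  Rabs s < sigma -> Rabs t < sigma -> Rabs w < sigma ->
  Rabs (G s t w) <= 8 * M * INR (fact l) * (2 * P) ^ l.
Proof.
  intros Hc HG Hs Ht Hw. rewrite (expands_Series l c G) by auto.
  eapply Rle_trans.
  - apply (nested_Series_bound _ _ (1 / 2) ltac:(lra)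
      (fun i j k => term_bound l c s t w i j k Hc Hs Ht Hw)).
  - right. field.
Qed.

(** With $n=i+j+k$, the new factor $i+1$ is at most $n+1$, and
    $(n+1)\,(n+1+l)!/(n+1)!=(n+l+1)!/n!$. *)
Lemma coef_bound_D1 l c : coef_bound M P l c ->
  coef_bound M P (S l) (fun i j k => INR (S i) * c (S i) j k).
Proof.
  intros H i j k. rewrite Rabs_mult, (Rabs_pos_eq (INR (S i))) by apply pos_INR.
  pose proof (H (S i) j k) as Hc. set (n := (i + j + k)%nat).
  replace (S i + j + k)%nat with (S n) in Hc by (unfold n; lia).
  replace (n + S l)%nat with (S n + l)%nat by lia.
  pose proof (INR_fact_lt_0 n) as Hn.
  assert (Hi : INR (S i) <= INR (S n)) by (apply le_INR; unfold n; lia).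
  apply Rle_trans with (INR (S n) * Rabs (c (S i) j k)).
  - apply Rmult_le_compat_r; [apply Rabs_pos|exact Hi].
  - apply Rle_trans with (INR (S n) * (M * (INR (fact (S n + l)) /
      INR (fact (S n))) * P ^ (S n + l))).
    + apply Rmult_le_compat_l; [apply pos_INR|exact Hc].
    + right. rewrite (fact_simpl n), mult_INR. field. split; [lra|].
      apply not_0_INR. lia.
Qed.

(* Summing over [j] and [k] first turns [G] into a power series in [s] alone;
   the derivatives in [t] and [w] follow by permuting the indices. *)
Lemma expands_D1 l c G : coef_bound M P l c -> expands sigma c G ->
  expands sigma (fun i j k => INR (S i) * c (S i) j k)
    (fun s t w => Derive (fun z => G z t w) s).
Proof.
  intros Hc HG s t w Hs Ht Hw.
  set (a := fun i => Series (fun j => Series (fun k =>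
    c i j k * t ^ j * w ^ k))).
  assert (HGa : forall z, Rabs z < sigma -> G z t w = PSeries a z).
  { intros z Hz. rewrite (expands_Series l c G) by auto. apply Series_ext. intros i.
    unfold a. rewrite Rmult_comm, <- Series_scal_l. apply Series_ext. intros j.
    rewrite <- Series_scal_l. apply Series_ext. intros k. ring. }
  assert (Hnear : locally s (fun z => Rabs z < sigma)).
  { assert (Hd : 0 < sigma - Rabs s) by lra. exists (mkposreal _ Hd).
    intros z Hz. change (Rabs (z - s) < sigma - Rabs s) in Hz.
    pose proof (Rabs_triang (z - s) s) as Htri.
    unfold Rminus in Htri. rewrite Rplus_assoc, Rplus_opp_l, Rplus_0_r in Htri.
    unfold Rminus in Hz. lra. }
  (* The point [r] lies halfway between [Rabs s] and [sigma]; absolute convergence there puts [s]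
     strictly inside the disc of convergence. *)
  assert (Hrad : Rbar_lt (Rabs s) (CV_radius a)).
  { set (r := (Rabs s + sigma) / 2).
    assert (Hr : Rabs r < sigma) by
      (pose proof (Rabs_pos s); unfold r; rewrite Rabs_pos_eq; lra).
    apply Rbar_lt_le_trans with r; [simpl; unfold r; lra|].
    apply (proj1 (Lub_Rbar_correct (CV_disk a))).
    apply ex_series_dominated with
      (fun i => (M * INR (fact l) * (2 * P) ^ l / (1 - 1 / 2) / (1 - 1 / 2))
        * (1 / 2) ^ i); [|apply ex_series_geom_scal; lra].
    intros i. eapply Rle_trans; [|apply (nested_Series_bound _ _ (1 / 2)
      ltac:(lra) (fun i j k => term_bound l c r t w i j k Hc Hr Ht Hw))].
    right. f_equal. unfold a. rewrite Rmult_comm, <- Series_scal_l.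
    apply Series_ext. intros j. rewrite <- Series_scal_l. apply Series_ext.
    intros k. ring. }
  assert (HD : Derive (fun z => G z t w) s = PSeries (PS_derive a) s).
  { rewrite (Derive_ext_loc _ (PSeries a)).
    - now apply is_derive_unique, is_derive_PSeries.
    - generalize Hnear. apply filter_imp. exact HGa. }
  rewrite HD.
  replace (PSeries (PS_derive a) s) with
    (Series (fun i => Series (fun j => Series (fun k =>
      INR (S i) * c (S i) j k * s ^ i * t ^ j * w ^ k)))).
  - apply (is_lim_seq_cube_sum _ _ (1 / 2) ltac:(lra)
      (fun i j k => term_bound (S l) _ s t w i j k (coef_bound_D1 l c Hc)
         Hs Ht Hw)).
  - apply Series_ext. intros i. unfold PS_derive, a.
    rewrite (Rmult_comm _ (s ^ i)), <- Rmult_assoc, <- Series_scal_l.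
    apply Series_ext. intros j. rewrite <- Series_scal_l.
    apply Series_ext. intros k. ring.
Qed.

Lemma Derive_shift (F : R -> R) x s :
  Derive (fun z => F (x + z)) s = Derive F (x + s).
Proof.
  unfold Derive. f_equal. apply Lim_ext. intros h. now rewrite Rplus_assoc.
Qed.

(** Only [l] advances along the word; [M], [P] and [sigma] are the same for every order, so all
    derivatives are expanded on one cube. *)
Lemma expands_dw x y p f c0 (wd : list (coord (R * R * R))) : incl wd coords3 ->
  coef_bound M P 0 c0 ->
  expands sigma c0 (fun s t w => f (x + s, y + t, p + w)) ->
  exists c, coef_bound M P (length wd) c /\
    expands sigma c (fun s t w => dw wd f (x + s, y + t, p + w)).
Proof.
  intros Hwd Hc0 Hf. induction wd as [|d wd IH]; [now exists c0|].
  destruct IH as [c [Hc HG]]; [intros e He; apply Hwd; now right|].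
  assert (Hd : In d coords3) by (apply Hwd; now left).
  simpl length. destruct Hd as [<-|[<-|[<-|[]]]].
  - eexists; split; [apply coef_bound_D1, Hc|].
    eapply expands_ext; [|apply expands_D1 with (1 := Hc), HG].
    intros s t w _ _ _.
    apply (Derive_shift (fun z => dw wd f (z, y + t, p + w)) x s).
  - apply coef_bound_swap12 in Hc. apply expands_swap12 in HG.
    eexists; split; [apply coef_bound_swap12, coef_bound_D1, Hc|].
    eapply expands_ext; [|apply expands_swap12, expands_D1 with (1 := Hc), HG].
    intros s t w _ _ _.
    apply (Derive_shift (fun z => dw wd f (x + s, z, p + w)) y t).
  (* The two transpositions rotate the third variable into first position, where [expands_D1]
     differentiates; the reverse rotation restores the order. *)
  - apply coef_bound_swap23, coef_bound_swap12 in Hc.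
    apply expands_swap23, expands_swap12 in HG.
    eexists; split;
      [apply coef_bound_swap23, coef_bound_swap12, coef_bound_D1, Hc|].
    eapply expands_ext; [|apply expands_swap23, expands_swap12, expands_D1 with (1 := Hc), HG].
    intros s t w _ _ _.
    apply (Derive_shift (fun z => dw wd f (x + s, y + t, z)) p w).
Qed.

End Cauchy.

(** * Power series in rho with smooth coefficients *)

(** By the mean value theorem each difference quotient is a value of [dv k] nearby, hence bounded by
    [b k]; Tannery's theorem on the punctured neighbourhoods of 0 gives the limit. *)
Lemma is_derive_Series_dominated (v dv : nat -> R -> R) (b : nat -> R) (t0 : R) :
  locally t0 (fun t => forall k, is_derive (v k) t (dv k t)) ->
  locally t0 (fun t => forall k, Rabs (dv k t) <= b k) -> ex_series b ->
  locally t0 (fun t => ex_series (fun k => v k t)) ->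
  is_derive (fun t => Series (fun k => v k t)) t0 (Series (fun k => dv k t0)).
Proof.
  intros Hd Hdom Hb Hex.
  apply is_derive_Reals.
  assert (HT : filterlim (fun h => Series (fun k => (v k (t0 + h) - v k t0) / h))
    (locally' 0) (locally (Series (fun k => dv k t0)))).
  { apply filterlim_Series with b; [exact (Rbar_locally'_filter 0)| | |exact Hb].
    - intros k P [eps Heps].
      assert (Hk : is_derive (v k) t0 (dv k t0)) by
        exact (locally_singleton _ _ Hd k).
      apply is_derive_Reals in Hk.
      destruct (Hk eps (cond_pos eps)) as [delta Hdelta]. exists delta.
      intros h Hh Hh0. apply Heps. apply Hdelta; auto.
      change (Rabs (h - 0) < delta) in Hh. now rewrite Rminus_0_r in Hh.
    - destruct (filter_and _ _ Hd Hdom) as [delta Hdelta]. exists delta.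
      intros h Hh Hh0 k.
      change (Rabs (h - 0) < delta) in Hh. rewrite Rminus_0_r in Hh.
      assert (Hin : forall x, Rmin t0 (t0 + h) <= x <= Rmax t0 (t0 + h) ->
        ball t0 delta x).
      { intros x Hx. change (Rabs (x - t0) < delta).
        apply Rabs_def2 in Hh. revert Hx. unfold Rmin, Rmax.
        destruct (Rle_dec t0 (t0 + h)); intros; apply Rabs_def1; lra. }
      destruct (MVT_gen (v k) t0 (t0 + h) (dv k)) as [x [Hx Heq]].
      + intros x Hx. apply Hdelta, Hin. lra.
      + intros x Hx. apply continuity_pt_filterlim.
        apply (ex_derive_continuous (v k) x). eexists.
        apply (proj1 (Hdelta x (Hin x Hx))).
      + rewrite Heq. replace (dv k x * (t0 + h - t0) / h) with (dv k x)
          by (field; exact Hh0).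
        apply (proj2 (Hdelta x (Hin x Hx))). }
  intros eps Heps.
  destruct (proj1 (filterlim_locally _ _) HT (mkposreal _ Heps)) as [d1 H1].
  destruct Hex as [d2 H2].
  (* The radius [d2] ensures convergence at [t0 + h], so that the series of quotients splits into a
     difference of two sums. *)
  exists (mkposreal _ (Rmin_stable_in_posreal d1 d2)). simpl. intros h Hh0 Hh.
  assert (Hh1 : Rabs h < d1) by (eapply Rlt_le_trans; [exact Hh|apply Rmin_l]).
  assert (Hh2 : Rabs h < d2) by (eapply Rlt_le_trans; [exact Hh|apply Rmin_r]).
  assert (Hb1 : ball 0 d1 h).
  { change (Rabs (h - 0) < d1). now rewrite Rminus_0_r. }
  pose proof (H1 h Hb1 Hh0) as H1'.
  change (Rabs (Series (fun k => (v k (t0 + h) - v k t0) / h)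
    - Series (fun k => dv k t0)) < eps) in H1'.
  replace (_ / h) with (Series (fun k => (v k (t0 + h) - v k t0) / h)); auto.
  rewrite <- Series_minus.
  - unfold Rdiv. now rewrite Series_scal_r.
  - apply H2. change (Rabs (t0 + h - t0) < d2).
    now replace (t0 + h - t0) with h by ring.
  - apply H2. apply ball_center.
Qed.

(** Induction through differentiation of power series: $(k+1)^{d+1}\le(k+1)(k+2)^d$, and the
    right-hand side is the $k$-th coefficient of the derivative of $\sum(k+1)^dt^k$. *)
Lemma ex_series_poly_geom d t : 0 <= t < 1 ->
  ex_series (fun k => INR (S k) ^ d * t ^ k).
Proof.
  revert t. induction d as [|d IH]; intros t Ht.
  - apply ex_series_ext with (fun k => 1 * t ^ k); [intros; simpl; ring|].
    now apply ex_series_geom_scal.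
  - set (a := fun k => INR (S k) ^ d).
    assert (Ha : forall k, 0 <= a k) by (intros; apply pow_le, pos_INR).
    assert (Hrad : Rbar_lt (Rabs t) (CV_radius (PS_derive a))).
    { rewrite CV_radius_derive. set (r := (t + 1) / 2).
      apply Rbar_lt_le_trans with r;
        [simpl; unfold r; rewrite Rabs_pos_eq; lra|].
      apply (proj1 (Lub_Rbar_correct (CV_disk a))).
      apply ex_series_dominated with (fun k => INR (S k) ^ d * r ^ k).
      - intros k. right. apply Rabs_pos_eq.
        apply Rmult_le_pos; [apply Ha|apply pow_le; unfold r; lra].
      - apply IH. unfold r. lra. }
    apply CV_disk_inside in Hrad.
    apply (ex_series_le (K := R_AbsRing) (V := R_CompleteNormedModule))
      with (2 := Hrad).
    intros k. change norm with Rabs. rewrite !Rabs_mult.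
    apply Rmult_le_compat_r; [apply Rabs_pos|].
    unfold PS_derive, a. rewrite !Rabs_pos_eq.
    + change (INR (S k) ^ S d) with (INR (S k) * INR (S k) ^ d).
      apply Rmult_le_compat_l; [apply pos_INR|].
      apply pow_incr. split; [apply pos_INR|apply le_INR; lia].
    + apply Rmult_le_pos; [apply pos_INR|apply pow_le, pos_INR].
    + apply pow_le, pos_INR.
Qed.

(** [M] and [d] may depend on the word and the point, but [K] may not. The polynomial factor absorbs
    the cost of every derivative, including the factor $k$ from $\partial_\varrho$, so all derived
    series converge on the same [tube]. *)
Definition geom_family (D : R * R * R -> Prop) (K : R) (g : fps) : Prop :=
  (forall k, smooth coords3 D (g k)) /\
  forall w, incl w coords3 -> forall q, D q -> exists M d, locally q (fun z =>
    forall k, Rabs (dw w (g k) z) <= M * INR (S k) ^ d * K ^ k).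

Definition fps_sum (g : fps) (z : R * R * R * R) : R :=
  PSeries (fun k => g k (fst z)) (snd z).

Definition tube (D : R * R * R -> Prop) (K : R) (z : R * R * R * R) : Prop :=
  D (fst z) /\ K * Rabs (snd z) < 1.

Lemma open_tube D K : open D -> open (tube D K).
Proof.
  intros HD. apply open_and.
  - apply (open_comp fst D); [intros [q r] _; apply continuous_fst|exact HD].
  - apply (open_comp (fun z : R * R * R * R => K * Rabs (snd z)) (fun s => s < 1));
      [|apply open_lt].
    intros [q r] _.
    apply (continuous_scal_r K (fun z : R * R * R * R => Rabs (snd z))).
    apply (continuous_comp snd Rabs); [apply continuous_snd|].
    apply continuous_Rabs.
Qed.

Section Family.
Variables (D : R * R * R -> Prop) (K : R).
Hypotheses (HD : open D) (HK : 0 < K).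

Lemma geom_family_ext g1 g2 : (forall k z, D z -> g1 k z = g2 k z) ->
  geom_family D K g1 -> geom_family D K g2.
Proof.
  intros H [Hs Hb]. split.
  - intros k. apply smooth_ext with (g1 k); auto. exact lawful_coords3.
  - intros w Hw q Hq. destruct (Hb w Hw q Hq) as [M [d Hloc]]. exists M, d.
    generalize (filter_and _ _ Hloc (HD q Hq)). apply filter_imp.
    intros z [Hz HDz] k. rewrite <- (dw_ext_on coords3 w D (g1 k)); auto.
    exact lawful_coords3.
Qed.

Lemma geom_family_pd c g : In c coords3 -> geom_family D K g ->
  geom_family D K (fun k => pd c (g k)).
Proof.
  intros Hc [Hs Hb]. split.
  - intros k. now apply smooth_pd.
  - intros w Hw q Hq.
    destruct (Hb (w ++ [c])) with (q := q) as [M [d Hloc]]; auto.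
    + intros e He. apply in_app_or in He as [He|[<-|[]]]; auto.
    + exists M, d. generalize Hloc. apply filter_imp. intros z Hz k.
      specialize (Hz k). now rewrite dw_app in Hz.
Qed.

Lemma geom_family_scal a g : geom_family D K g -> geom_family D K (fun k q => a * g k q).
Proof.
  intros [Hs Hb]. split.
  - intros k. apply smooth_mult; auto; [exact lawful_coords3|apply smooth_const].
  - intros w Hw q Hq. destruct (Hb w Hw q Hq) as [M [d Hloc]].
    exists (Rabs a * M), d. generalize Hloc. apply filter_imp. intros z Hz k.
    rewrite dw_scal, Rabs_mult, !Rmult_assoc, <- (Rmult_assoc M).
    apply Rmult_le_compat_l; [apply Rabs_pos|apply Hz].
Qed.

Lemma INR_S_ge_1 k : 1 <= INR (S k).
Proof. rewrite S_INR. pose proof (pos_INR k). lra. Qed.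

Lemma poly_bound_weaken M d d' k : (d <= d')%nat ->
  M * INR (S k) ^ d * K ^ k <= Rabs M * INR (S k) ^ d' * K ^ k.
Proof.
  intros H. apply Rmult_le_compat_r; [apply pow_le; lra|].
  apply Rle_trans with (Rabs M * INR (S k) ^ d).
  - apply Rmult_le_compat_r; [apply pow_le, pos_INR|apply Rle_abs].
  - apply Rmult_le_compat_l; [apply Rabs_pos|].
    apply Rle_pow; [apply INR_S_ge_1|exact H].
Qed.

Lemma geom_family_plus g1 g2 : geom_family D K g1 -> geom_family D K g2 ->
  geom_family D K (fun k q => g1 k q + g2 k q).
Proof.
  intros [Hs1 Hb1] [Hs2 Hb2]. split.
  - intros k. apply smooth_plus; auto. exact lawful_coords3.
  - intros w Hw q Hq. destruct (Hb1 w Hw q Hq) as [M1 [d1 Hl1]].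
    destruct (Hb2 w Hw q Hq) as [M2 [d2 Hl2]].
    exists (Rabs M1 + Rabs M2), (d1 + d2)%nat.
    generalize (filter_and _ _ (HD q Hq) (filter_and _ _ Hl1 Hl2)).
    apply filter_imp. intros z [HDz [Hz1 Hz2]] k.
    rewrite (dw_plus coords3 w D); auto; [|exact lawful_coords3].
    eapply Rle_trans; [apply Rabs_triang|].
    rewrite !Rmult_plus_distr_r. apply Rplus_le_compat;
      (eapply Rle_trans; [apply Hz1 || apply Hz2|]; apply poly_bound_weaken; lia).
Qed.

Lemma geom_family_derive g : geom_family D K g ->
  geom_family D K (fun k q => INR (S k) * g (S k) q).
Proof.
  intros [Hs Hb]. split.
  - intros k. apply smooth_mult; auto; [exact lawful_coords3|apply smooth_const].
  - intros w Hw q Hq. destruct (Hb w Hw q Hq) as [M [d Hloc]].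
    (* From $k+2\le2(k+1)$ comes [2 ^ d], from the shifted power of [K] one factor [K], and the
       multiplier $k+1$ raises the degree by one. *)
    exists (Rabs M * 2 ^ d * K), (S d).
    generalize Hloc. apply filter_imp. intros z Hz k.
    rewrite dw_scal, Rabs_mult, (Rabs_pos_eq (INR (S k))) by apply pos_INR.
    apply Rle_trans with (INR (S k) * (Rabs M * (2 * INR (S k)) ^ d * K ^ S k)).
    + apply Rmult_le_compat_l; [apply pos_INR|].
      eapply Rle_trans; [apply Hz|].
      eapply Rle_trans; [apply poly_bound_weaken, Nat.le_refl|].
      apply Rmult_le_compat_r; [apply pow_le; lra|].
      apply Rmult_le_compat_l; [apply Rabs_pos|].
      apply pow_incr. split; [apply pos_INR|].
      rewrite (S_INR (S k)). pose proof (INR_S_ge_1 k). lra.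
    + right. rewrite Rpow_mult_distr. cbn [pow]. ring.
Qed.

Lemma geom_family_fps_rho phi : smooth coords3 D phi -> geom_family D K (fps_rho phi).
Proof.
  intros H.
  assert (Hs : forall k, smooth coords3 D (fps_rho phi k)).
  { intros [|[|k]]; [exact (smooth_const _ _ 0)|exact H|exact (smooth_const _ _ 0)]. }
  split; [exact Hs|]. intros w Hw q Hq.
  assert (Hzero : forall k z, k <> 1%nat -> dw w (fps_rho phi k) z = 0).
  { intros k z Hk. rewrite <- (Rmult_0_l (dw w (fun _ => 0) z)), <- dw_scal.
    unfold fps_rho. destruct k as [|[|k]]; [|congruence|];
      f_equal; f_equal; apply functional_extensionality;
      intros; ring. }
  set (m := Rabs (dw w phi q) + 1).
  (* Only the index 1 contributes, where [K ^ 1] cancels the division; [m] bounds the derivative of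
     [phi] near [q] by continuity. *)
  exists (m / K), 0%nat.
  assert (Hc : continuous (dw w phi) q).
  { apply smooth_continuous with coords3 D; auto. now apply smooth_dw. }
  generalize (proj1 (filterlim_locally _ _) Hc (mkposreal 1 Rlt_0_1)).
  apply filter_imp. intros z Hz k.
  change (Rabs (dw w phi z - dw w phi q) < 1) in Hz.
  assert (Hm : Rabs (dw w phi z) <= m).
  { pose proof (Rabs_triang_inv (dw w phi z) (dw w phi q)). unfold m. lra. }
  destruct (Nat.eq_dec k 1) as [->|Hk].
  - simpl. change (Rabs (dw w phi z) <= m / K * 1 * (K * 1)).
    replace (m / K * 1 * (K * 1)) with m by (field; lra). exact Hm.
  - rewrite Hzero, Rabs_R0 by exact Hk. pose proof (Rabs_pos (dw w phi z)).
    apply Rmult_le_pos; [|apply pow_le; lra].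
    apply Rmult_le_pos; [|apply pow_le, pos_INR].
    apply Rle_div_r; lra.
Qed.

Lemma geom_family_dominated g w z0 : geom_family D K g -> incl w coords3 -> tube D K z0 ->
  exists b, ex_series b /\ locally z0 (fun z =>
    forall k, Rabs (dw w (g k) (fst z) * snd z ^ k) <= b k).
Proof.
  intros [_ Hb] Hw [Hq Hr]. destruct z0 as [q rho]. cbn [fst snd] in *.
  destruct (Hb w Hw q Hq) as [M [d Hloc]].
  (* A ratio strictly between [K * Rabs rho] and 1: room to move [rho] slightly while keeping one
     summable bound. *)
  set (theta := (K * Rabs rho + 1) / 2).
  assert (Hpos : 0 <= K * Rabs rho)
    by (apply Rmult_le_pos; [lra|apply Rabs_pos]).
  assert (Ht : K * Rabs rho < theta < 1) by (unfold theta; lra).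
  exists (fun k => Rabs M * (INR (S k) ^ d * theta ^ k)). split.
  { apply (ex_series_scal_l (Rabs M) (fun k => INR (S k) ^ d * theta ^ k)).
    apply ex_series_poly_geom. lra. }
  assert (H1 : locally (q, rho) (fun z => forall k,
      Rabs (dw w (g k) (fst z)) <= M * INR (S k) ^ d * K ^ k)).
  { destruct Hloc as [e He]. exists e. intros z [Hz _]. now apply He. }
  assert (H2 : locally (q, rho) (fun z => K * Rabs (snd z) < theta)).
  { apply (open_comp (fun z : R * R * R * R => K * Rabs (snd z))
      (fun s => s < theta)); [|apply open_lt|exact (proj1 Ht)].
    intros [q' r] _.
    apply (continuous_scal_r K (fun z : R * R * R * R => Rabs (snd z))).
    apply (continuous_comp snd Rabs); [apply continuous_snd|].
    apply continuous_Rabs. }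
  generalize (filter_and _ _ H1 H2). apply filter_imp. intros z [Hz1 Hz2] k.
  rewrite Rabs_mult, <- RPow_abs.
  apply Rle_trans with (Rabs M * INR (S k) ^ d * K ^ k * Rabs (snd z) ^ k).
  - apply Rmult_le_compat_r; [apply pow_le, Rabs_pos|].
    eapply Rle_trans; [apply Hz1|apply poly_bound_weaken, Nat.le_refl].
  - rewrite (Rmult_assoc _ (K ^ k)), <- Rpow_mult_distr, Rmult_assoc.
    apply Rmult_le_compat_l; [apply Rabs_pos|].
    apply Rmult_le_compat_l; [apply pow_le, pos_INR|].
    apply pow_incr. split; [|lra].
    apply Rmult_le_pos; [lra|apply Rabs_pos].
Qed.

Lemma geom_family_ex_series g z : geom_family D K g -> tube D K z ->
  ex_series (fun k => Rabs (g k (fst z) * snd z ^ k)).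
Proof.
  intros Hg Hz. destruct (geom_family_dominated g [] z Hg) as [b [Hb Hl]]; auto.
  - intros c [].
  - apply ex_series_dominated with (2 := Hb). apply (locally_singleton _ _ Hl).
Qed.

Lemma geom_family_CV_radius g q rho : geom_family D K g -> tube D K (q, rho) ->
  Rbar_lt (Rabs rho) (CV_radius (fun k => g k q)).
Proof.
  intros Hg [Hq Hr]. cbn [fst snd] in *.
  set (r := (Rabs rho + / K) / 2).
  assert (Hr' : Rabs rho < / K).
  { apply Rmult_lt_reg_l with K; [exact HK|]. rewrite Rinv_r; lra. }
  pose proof (Rabs_pos rho).
  apply Rbar_lt_le_trans with r; [simpl; unfold r; lra|].
  apply (proj1 (Lub_Rbar_correct (CV_disk (fun k => g k q)))).
  apply (geom_family_ex_series g (q, r) Hg). split; [exact Hq|]. cbn [snd].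
  rewrite Rabs_pos_eq by (unfold r; lra).
  apply Rmult_lt_reg_l with (/ K); [now apply Rinv_0_lt_compat|].
  rewrite <- Rmult_assoc, Rinv_l, Rmult_1_l, Rmult_1_r; unfold r; lra.
Qed.

Lemma geom_family_ex_pseries g q rho : geom_family D K g -> tube D K (q, rho) ->
  ex_pseries (fun k => g k q) rho.
Proof. intros Hg Hz. now apply CV_radius_inside, geom_family_CV_radius. Qed.

Lemma fps_sum_continuous g z0 : geom_family D K g -> tube D K z0 ->
  continuous (fps_sum g) z0.
Proof.
  intros Hg Hz. destruct (geom_family_dominated g [] z0 Hg) as [b [Hb Hl]]; auto.
  { intros c []. }
  apply (filterlim_Series (locally z0) (fun k z => g k (fst z) * snd z ^ k)
    (fun k => g k (fst z0) * snd z0 ^ k) b); auto.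
  intros k. destruct z0 as [q rho].
  apply (continuous_mult (fun z : R * R * R * R => g k (fst z))
    (fun z : R * R * R * R => snd z ^ k) (q, rho)).
  - apply (continuous_comp fst (g k)); [apply continuous_fst|].
    apply smooth_continuous with coords3 D; [apply Hg|apply Hz].
  - apply (continuous_comp snd (fun r => r ^ k)); [apply continuous_snd|].
    apply (ex_derive_continuous (fun r : R => r ^ k)). auto_derive. exact I.
Qed.

Lemma fps_sum_is_derive_space c g q rho : In c coords3 -> geom_family D K g ->
  tube D K (q, rho) ->
  is_derive (fun t => fps_sum g (upd c q t, rho)) (get c q)
    (fps_sum (fun k => pd c (g k)) (q, rho)).
Proof.
  intros Hc Hg Hz. pose proof (lawful_coords3 c Hc) as Hlaw.
  assert (Hline : filterlim (fun t => (upd c q t, rho)) (locally (get c q))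
    (locally (q, rho))).
  { intros P [e He].
    generalize (upd_cont c Hlaw q _ (locally_ball q e)). unfold filtermap.
    apply filter_imp.
    intros t Ht. apply He. split; [exact Ht|apply ball_center]. }
  destruct (geom_family_dominated g [c] (q, rho) Hg) as [b [Hb Hl]]; auto.
  { intros e [<-|[]]. exact Hc. }
  (* The sum is written at [upd c q (get c q)], the point of parameter [get c q] on the line, to
     match the shape of [is_derive_Series_dominated]. *)
  replace (fps_sum (fun k => pd c (g k)) (q, rho)) with
    (Series (fun k => pd c (g k) (upd c q (get c q)) * rho ^ k))
    by now rewrite (upd_get c Hlaw).
  pose proof (Hline _ (open_tube D K HD (q, rho) Hz)) as Htube.
  unfold filtermap in Htube.
  apply (is_derive_Series_dominated (fun k t => g k (upd c q t) * rho ^ k)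
    (fun k t => pd c (g k) (upd c q t) * rho ^ k) b).
  - generalize Htube. apply filter_imp. intros t [Ht _] k. cbn [fst] in Ht.
    rewrite (pd_line c _ _ _ Hlaw).
    apply (is_derive_scal_l (fun s => g k (upd c q s)) t _ (rho ^ k)).
    apply Derive_correct.
    apply ex_derive_line; [exact Hlaw|].
    apply smooth_ex_derive with coords3 D; auto. apply Hg.
  - generalize (Hline _ Hl). unfold filtermap. apply filter_imp. intros t Ht. exact Ht.
  - exact Hb.
  - generalize Htube. apply filter_imp. intros t Ht.
    apply ex_series_Rabs. exact (geom_family_ex_series g _ Hg Ht).
Qed.

Lemma fps_sum_is_derive_rho g q rho : geom_family D K g -> tube D K (q, rho) ->
  is_derive (fun t => fps_sum g (q, t)) rho
    (fps_sum (fun k z => INR (S k) * g (S k) z) (q, rho)).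
Proof.
  intros Hg Hz. apply (is_derive_PSeries (fun k => g k q) rho).
  now apply geom_family_CV_radius.
Qed.

Lemma fps_sum_pd_space c3 c4 g z : In (c3, c4) [(x3, x4); (y3, y4); (p3, p4)] ->
  geom_family D K g -> tube D K z ->
  ex_derive (fun t => fps_sum g (upd c4 z t)) (get c4 z) /\
  pd c4 (fps_sum g) z = fps_sum (fun k => pd c3 (g k)) z.
Proof.
  intros Hin Hg Hz. destruct z as [[[x y] p] rho].
  assert (Hc : In c3 coords3)
    by (destruct Hin as [E|[E|[E|[]]]]; injection E as <- <-; simpl; auto).
  assert (Hd : is_derive (fun t => fps_sum g (upd c4 (x, y, p, rho) t))
    (get c4 (x, y, p, rho)) (fps_sum (fun k => pd c3 (g k)) (x, y, p, rho))).
  { pose proof (fps_sum_is_derive_space c3 g (x, y, p) rho Hc Hg Hz) as H.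
    destruct Hin as [E|[E|[E|[]]]]; injection E as <- <-; exact H. }
  split; [eexists; exact Hd|now apply is_derive_unique].
Qed.

Lemma fps_sum_pd_rho g z : geom_family D K g -> tube D K z ->
  ex_derive (fun t => fps_sum g (upd rho4 z t)) (get rho4 z) /\
  pd rho4 (fps_sum g) z = fps_sum (fun k q => INR (S k) * g (S k) q) z.
Proof.
  intros Hg Hz. destruct z as [[[x y] p] rho].
  pose proof (fps_sum_is_derive_rho g (x, y, p) rho Hg Hz) as Hd.
  split; [eexists; exact Hd|now apply is_derive_unique].
Qed.

(** Every first partial derivative of a sum is again the sum of a [geom_family] with the same [D]
    and [K], so induction on the order stays on one tube. *)
Lemma Cn_fps_sum n g : geom_family D K g -> Cn coords4 n (tube D K) (fps_sum g).
Proof.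
  revert g. induction n as [|n IH]; intros g Hg;
    (split; [intros z Hz; now apply fps_sum_continuous|]); [exact I|].
  intros c Hc.
  assert (Hcase : c = rho4 \/ exists c3, In c3 coords3 /\
    In (c3, c) [(x3, x4); (y3, y4); (p3, p4)]).
  { destruct Hc as [<-|[<-|[<-|[<-|[]]]]]; [right|right|right|now left];
      [exists x3|exists y3|exists p3]; simpl; auto. }
  destruct Hcase as [->|[c3 [Hc3 Hin]]].
  - split; [intros z Hz; now apply fps_sum_pd_rho|].
    apply Cn_ext with (fps_sum (fun k q => INR (S k) * g (S k) q)).
    + exact lawful_coords4.
    + now apply open_tube.
    + intros z Hz. symmetry. now apply fps_sum_pd_rho.
    + now apply IH, geom_family_derive.
  - split; [intros z Hz; now apply (fps_sum_pd_space c3)|].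
    apply Cn_ext with (fps_sum (fun k => pd c3 (g k))).
    + exact lawful_coords4.
    + now apply open_tube.
    + intros z Hz. symmetry. now apply fps_sum_pd_space.
    + now apply IH, geom_family_pd.
Qed.

End Family.

(** * Convergence of the explicit solution *)

Lemma sum_n_term_le (a : nat -> R) i N : (forall k, 0 <= a k) -> (i <= N)%nat ->
  a i <= sum_n a N.
Proof.
  intros Ha Hi. induction Hi as [|N Hi IH].
  - destruct i as [|i]; [rewrite sum_O; apply Rle_refl|].
    rewrite sum_Sn. change (a (S i) <= sum_n a i + a (S i)).
    assert (0 <= sum_n a i); [|lra].
    rewrite sum_n_Reals. now apply cond_pos_sum.
  - rewrite sum_Sn. change (a i <= sum_n a N + a (S N)).
    specialize (Ha (S N)). lra.
Qed.

Lemma sum_n_nonneg (a : nat -> R) N : (forall k, 0 <= a k) -> 0 <= sum_n a N.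
Proof. intros Ha. rewrite sum_n_Reals. now apply cond_pos_sum. Qed.

Lemma cube_sum_term_le u i j k N : (forall i j k, 0 <= u i j k) ->
  (i <= N)%nat -> (j <= N)%nat -> (k <= N)%nat -> u i j k <= cube_sum u N.
Proof.
  intros Hu Hi Hj Hk.
  apply Rle_trans with (sum_n (fun k => u i j k) N).
  { now apply (sum_n_term_le (fun k => u i j k)). }
  apply Rle_trans with (sum_n (fun j => sum_n (fun k => u i j k) N) N).
  { apply (sum_n_term_le (fun j => sum_n (fun k => u i j k) N)); auto.
    intros. now apply sum_n_nonneg. }
  apply (sum_n_term_le (fun i => sum_n (fun j => sum_n (fun k => u i j k) N) N));
    auto.
  intros. apply sum_n_nonneg. intros. now apply sum_n_nonneg.
Qed.

Lemma analytic_derivative_bounds U f x y p : analytic U f -> U (x, y, p) ->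
  exists sigma M Q, 0 < sigma /\ 0 <= M /\ 0 < Q /\
  forall w, incl w coords3 -> forall s t u,
    Rabs s < sigma -> Rabs t < sigma -> Rabs u < sigma ->
    Rabs (dw w f (x + s, y + t, p + u)) <=
      M * INR (fact (length w)) * Q ^ length w.
Proof.
  intros Hf Hq. destruct (Hf x y p Hq) as [c [r [Hr Hc]]].
  (* Absolute convergence at $(r/2,r/2,r/2)$ bounds each coefficient by $M(2/r)^{i+j+k}$, that is
     [coef_bound] with $P=2/r$ and $l=0$. *)
  assert (Hr2 : Rabs (r / 2) < r) by (rewrite Rabs_pos_eq; lra).
  destruct (Hc _ _ _ Hr2 Hr2 Hr2) as [[M HM] _].
  assert (Hterm : forall i j k,
    Rabs (c i j k * (r / 2) ^ i * (r / 2) ^ j * (r / 2) ^ k) <= M).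
  { intros i j k. eapply Rle_trans; [|apply (HM (i + j + k)%nat)].
    apply (cube_sum_term_le (fun i j k =>
      Rabs (c i j k * (r / 2) ^ i * (r / 2) ^ j * (r / 2) ^ k)));
      try lia. intros. apply Rabs_pos. }
  assert (HM0 : 0 <= M)
    by (eapply Rle_trans; [apply Rabs_pos|apply (Hterm 0%nat 0%nat 0%nat)]).
  assert (HP : 0 < 2 / r) by (apply Rdiv_lt_0_compat; lra).
  assert (Hbound : coef_bound M (2 / r) 0 c).
  { intros i j k. rewrite Nat.add_0_r.
    pose proof (INR_fact_lt_0 (i + j + k)).
    replace (INR _ / INR _) with 1 by (field; lra). rewrite Rmult_1_r.
    rewrite !pow_add.
    replace (2 / r) with (/ (r / 2)) by (field; lra). rewrite !pow_inv.
    assert (Hp : forall n, 0 < (r / 2) ^ n) by (intros; apply pow_lt; lra).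
    specialize (Hterm i j k). rewrite !Rabs_mult in Hterm.
    rewrite !(Rabs_pos_eq ((r / 2) ^ _)) in Hterm by (left; apply Hp).
    pose proof (Hp i). pose proof (Hp j). pose proof (Hp k).
    rewrite <- !Rinv_mult.
    apply Rle_div_r; [now repeat apply Rmult_lt_0_compat|]. lra. }
  (* With $P=2/r$, the choice $\sigma=r/8$ gives $4P\sigma=1$; [8 * M] and $2P$ are the constants of
     [expands_bound]. *)
  exists (r / 8), (8 * M), (2 * (2 / r)).
  split; [lra|split; [lra|split; [lra|]]].
  intros w Hw s t u Hs Ht Hu.
  assert (Hsig : 4 * (2 / r) * (r / 8) <= 1) by (right; field; lra).
  destruct (expands_dw M (2 / r) (r / 8) HM0 HP Hsig x y p f c w Hw Hbound)
    as [c' [Hc' HG]].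
  - intros s' t' u' Hs' Ht' Hu'. apply Hc; lra.
  - apply (expands_bound M (2 / r) (r / 8) HM0 HP Hsig _ c'
      (fun s t u => dw w f (x + s, y + t, p + u)) s t u Hc' HG Hs Ht Hu).
Qed.

(** For fixed [a] this bounds $(m+a)!/m!$ by a polynomial in $m$, which is all that additional
    derivatives cost. *)
Lemma fact_add_le m a : (fact (m + a) <= fact m * (m + a) ^ a)%nat.
Proof.
  induction a as [|a IH].
  - rewrite Nat.add_0_r. simpl. lia.
  - rewrite Nat.add_succ_r, fact_simpl, Nat.pow_succ_r'.
    rewrite Nat.mul_assoc, (Nat.mul_comm (fact m)), <- Nat.mul_assoc.
    apply Nat.mul_le_mono_l. etransitivity; [exact IH|].
    apply Nat.mul_le_mono_l, Nat.pow_le_mono_l. lia.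
Qed.

(** The $2k$ derivatives of [f] cost $(2k)!\,Q^{2k}$ up to a polynomial in $k$, and the bound on
    [u k] divides by $(2k)!$. What remains is the rate [Q ^ 2]. *)
Lemma geom_family_fpart (U D : R * R * R -> Prop) f M Q Cu du u e :
  open D -> (forall q, D q -> U q) -> smooth coords3 U f ->
  0 <= M -> 0 < Q ->
  (forall w, incl w coords3 -> forall q, D q ->
    Rabs (dw w f q) <= M * INR (fact (length w)) * Q ^ length w) ->
  (forall k, Rabs (u k) <= Cu * INR (S k) ^ du / INR (fact (2 * k))) ->
  geom_family D (Q ^ 2) (fpart f u e).
Proof.
  intros HD HDU Hf HM HQ Hbound Hu. split.
  { intros k. apply smooth_fpart; auto. now apply smooth_sub with U. }
  intros w Hw q Hq. set (l := length w).
  exists (Cu * M * Q ^ (l + e) * INR (l + e + 2) ^ (l + e)), (du + (l + e))%nat.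
  generalize (HD q Hq). apply filter_imp. intros z Hz k.
  assert (HCu : 0 <= Cu).
  { pose proof (Hu 0%nat) as H0. simpl in H0. rewrite pow1 in H0.
    pose proof (Rabs_pos (u 0%nat)). lra. }
  assert (HS : 1 <= INR (S k)) by apply INR_S_ge_1.
  assert (Hrhs : 0 <= Cu * M * Q ^ (l + e) * INR (l + e + 2) ^ (l + e)
    * INR (S k) ^ (du + (l + e)) * (Q ^ 2) ^ k).
  { repeat apply Rmult_le_pos; try apply pow_le; auto using pos_INR; try lra.
    apply pow_le; lra. }
  destruct k as [|k'].
  { assert (H0 : dw w (fpart f u e 0) z = 0).
    { rewrite <- (Rmult_0_l (dw w (fun _ => 0) z)), <- dw_scal.
      f_equal. f_equal.
      apply functional_extensionality.
      intros. simpl. ring. }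
    now rewrite H0, Rabs_R0. }
  unfold fpart. set (k := S k') in *.
  rewrite dw_scal, dp_dw, <- dw_app, Rabs_mult.
  set (wd := w ++ repeat p3 (2 * k + e)).
  assert (Hlen : length wd = (2 * k + (l + e))%nat).
  { unfold wd. rewrite length_app, repeat_length. fold l. lia. }
  assert (Hwd : incl wd coords3).
  { apply incl_app; [exact Hw|apply incl_repeat_p3]. }
  pose proof (Hbound wd Hwd z Hz) as Hb. rewrite Hlen in Hb.
  pose proof (INR_fact_lt_0 (2 * k)) as Hfact.
  (* Uses [fact_add_le] together with $2k+l+e\le(l+e+2)(k+1)$, which separates the dependence on
     $k$. *)
  assert (Hf1 : INR (fact (2 * k + (l + e))) <=
    INR (fact (2 * k)) * (INR (l + e + 2) ^ (l + e) * INR (S k) ^ (l + e))).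
  { eapply Rle_trans; [apply le_INR, fact_add_le|].
    rewrite mult_INR. apply Rmult_le_compat_l; [lra|].
    rewrite <- Rpow_mult_distr, pow_INR. apply pow_incr.
    split; [apply pos_INR|]. rewrite <- mult_INR. apply le_INR. nia. }
  apply Rle_trans with ((Cu * INR (S k) ^ du / INR (fact (2 * k))) *
    (M * (INR (fact (2 * k)) *
      (INR (l + e + 2) ^ (l + e) * INR (S k) ^ (l + e)))
      * Q ^ (2 * k + (l + e)))).
  - apply Rmult_le_compat; try apply Rabs_pos; [apply Hu|].
    eapply Rle_trans; [exact Hb|].
    apply Rmult_le_compat_r; [apply pow_le; lra|].
    now apply Rmult_le_compat_l.
  - right. rewrite <- pow_mult, !pow_add. field. lra.
Qed.

(** Here $2k+5\le7(k+1)$. The bounds 2 and 5 cover all linear factors of the solution, and powers of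
    7 give the constants 49, 343 and 2401. *)
Lemma linear_factor_bound (a b : R) k : Rabs a <= 2 -> Rabs b <= 5 ->
  Rabs (a * INR k - b) <= 7 * INR (S k).
Proof.
  intros Ha Hb. unfold Rminus. eapply Rle_trans; [apply Rabs_triang|].
  rewrite Rabs_Ropp, Rabs_mult, (Rabs_pos_eq (INR k)) by apply pos_INR.
  rewrite S_INR. pose proof (pos_INR k). nra.
Qed.

Lemma div_denom_bound N B k : Rabs N <= B ->
  Rabs (N / denom k) <= B / INR (fact (2 * k)).
Proof.
  intros H. pose proof (INR_fact_lt_0 (2 * k)) as Hf.
  pose proof (denom_pos k) as Hd.
  unfold Rdiv. rewrite Rabs_mult, Rabs_inv, (Rabs_pos_eq (denom k)) by lra.
  apply Rmult_le_compat; [apply Rabs_pos| |exact H|].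
  - left. now apply Rinv_0_lt_compat.
  - apply Rinv_le_contravar; [exact Hf|]. unfold denom.
    pose proof (pow_R1_Rle 2 (2 * k) ltac:(lra)). nra.
Qed.

Lemma cA_bound k : Rabs (cA k) <= 49 * INR (S k) ^ 2 / INR (fact (2 * k)).
Proof.
  apply div_denom_bound. rewrite !Rabs_mult.
  replace (49 * _) with (7 * INR (S k) * (7 * INR (S k))) by ring.
  apply Rmult_le_compat; try apply Rabs_pos; apply linear_factor_bound;
    rewrite Rabs_pos_eq; lra.
Qed.

Lemma cB_bound k : Rabs (cB k) <= 343 * INR (S k) ^ 3 / INR (fact (2 * k)).
Proof.
  apply div_denom_bound. rewrite !Rabs_mult.
  replace (343 * _) with (7 * INR (S k) * (7 * INR (S k)) * (7 * INR (S k)))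
    by ring.
  repeat (apply Rmult_le_compat; auto using Rabs_pos, Rmult_le_pos);
    apply linear_factor_bound; rewrite Rabs_pos_eq; lra.
Qed.

Lemma cC_bound k : Rabs (cC k) <= 2401 * INR (S k) ^ 4 / INR (fact (2 * k)).
Proof.
  apply div_denom_bound. rewrite !Rabs_mult.
  replace (2401 * _) with (7 * INR (S k) * (7 * INR (S k)) * (7 * INR (S k))
    * (7 * INR (S k))) by ring.
  (* The factor $k-3$ becomes $1\cdot k-3$, the shape required by [linear_factor_bound]. *)
  rewrite <- (Rmult_1_l (INR k)) at 1.
  repeat (apply Rmult_le_compat; auto using Rabs_pos, Rmult_le_pos);
    apply linear_factor_bound; rewrite Rabs_pos_eq; lra.
Qed.

Section Convergence.
Variables (U : R * R * R -> Prop) (V : R * R -> Prop)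
  (f : R * R * R -> R) (h : R * R -> R).
Hypotheses (hU : open U)
  (hUV : forall x y p, U (x, y, p) -> V (x, y))
  (hf : smooth coords3 U f) (hh : smooth coords2 V h).

Definition convergence_domain (D : R * R * R -> Prop) (K : R) : Prop :=
  open D /\ 0 < K /\ (forall q, D q -> U q) /\
  geom_family D K (solA f) /\ geom_family D K (solB f h) /\ geom_family D K (solC f h).

(** [D] is the intersection of [U] with the cube around [q] on which the factorial bounds hold, and
    [K = Q ^ 2] serves all three families. *)
Lemma exists_convergence_domain q : analytic U f -> U q ->
  exists D K, convergence_domain D K /\ D q.
Proof.
  intros Hf Hq. destruct q as [[x y] p].
  destruct (analytic_derivative_bounds U f x y p Hf Hq)
    as [sigma [M [Q [Hs [HM [HQ Hbound]]]]]].
  set (D := fun q : R * R * R => U q /\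
    (fun q => Rabs (fst (fst q) - x) < sigma /\ Rabs (snd (fst q) - y) < sigma
      /\ Rabs (snd q - p) < sigma) q).
  assert (HD : open D).
  { apply open_and; [exact hU|].
    repeat apply open_and;
    match goal with |- open (fun q => Rabs (@?g q - ?a) < _) =>
      apply (open_comp (fun q : R * R * R => Rabs (g q - a)) (fun s => s < sigma));
      [|apply open_lt] end;
    intros [[x' y'] p'] _;
    match goal with |- filterlim (fun q => Rabs (@?g q - ?a)) _ _ =>
      apply (continuous_comp (fun q : R * R * R => g q - a) Rabs);
      [|apply continuous_Rabs];
      apply (continuous_minus g (fun _ => a)); [|apply continuous_const] end.
    - apply (continuous_comp fst fst); apply continuous_fst.
    - apply (continuous_comp fst snd); [apply continuous_fst|apply continuous_snd].
    - apply continuous_snd. }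
  assert (HDU : forall q, D q -> U q) by (intros q [H _]; exact H).
  assert (Hb : forall w, incl w coords3 -> forall q, D q ->
    Rabs (dw w f q) <= M * INR (fact (length w)) * Q ^ length w).
  { intros w Hw [[x' y'] p'] [_ [H1 [H2 H3]]]. cbn [fst snd] in *.
    pose proof (Hbound w Hw _ _ _ H1 H2 H3) as H.
    now replace (x + (x' - x)) with x' in H by ring;
    replace (y + (y' - y)) with y' in H by ring;
    replace (p + (p' - p)) with p' in H by ring. }
  assert (HK : 0 < Q ^ 2) by (apply pow_lt; exact HQ).
  assert (Hpart := fun Cu du u e =>
    geom_family_fpart U D f M Q Cu du u e HD HDU hf HM HQ Hb).
  assert (HUV' : forall x y p, D (x, y, p) -> V (x, y))
    by (intros; eapply hUV, HDU; eassumption).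
  exists D, (Q ^ 2). split; [split; [exact HD|split; [exact HK|split;
    [exact HDU|split; [|split]]]]|].
  - eapply geom_family_ext; [exact HD|intros; symmetry; apply solA_eq|].
    apply geom_family_scal; [exact HD|]. eapply Hpart, cA_bound.
  - eapply geom_family_ext; [exact HD|intros; symmetry; apply solB_eq|].
    apply geom_family_plus; auto; apply geom_family_scal; auto.
    + apply geom_family_fps_rho; auto. apply smooth_h_y with V; auto.
    + eapply Hpart, cB_bound.
  - eapply geom_family_ext; [exact HD|intros; symmetry; apply solC_eq|].
    apply geom_family_plus; auto; [|apply geom_family_plus; auto]; apply geom_family_scal; auto.
    + apply geom_family_fps_rho; auto. apply smooth_h_sq with V; auto.
    + apply geom_family_fps_rho; auto. apply smooth_h_tr with V; auto.
    + eapply Hpart, cC_bound.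
  - split; [exact Hq|]. cbn [fst snd]. rewrite !Rminus_eq_0, Rabs_R0. auto.
Qed.

End Convergence.

(** * Taylor coefficients of analytic solutions *)

Lemma in_p4 : In p4 coords4.
Proof. simpl; auto. Qed.

Lemma in_rho4 : In rho4 coords4.
Proof. simpl; auto. Qed.

Lemma L_op_ext_on (W : R * R * R * R -> Prop) (F1 F2 : R * R * R * R -> R)
    (q : R * R * R) (rho : R) : open W -> (forall z, W z -> F1 z = F2 z) ->
  W (q, rho) -> L_op F1 q rho = L_op F2 q rho.
Proof.
  intros HW H Hz.
  assert (Hpd : forall c, In c coords4 -> forall z, W z -> pd c F1 z = pd c F2 z).
  { intros c Hc z Hw. apply pd_ext_on with W; auto. now apply lawful_coords4. }
  assert (Hpd2 : forall c, In c coords4 -> pd c (pd c F1) (q, rho) =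
    pd c (pd c F2) (q, rho)).
  { intros c Hc. apply pd_ext_on with W; auto. now apply lawful_coords4. }
  unfold L_op. rewrite !(Hpd2 _ in_p4), !(Hpd2 _ in_rho4), (Hpd _ in_rho4); auto.
Qed.

(** The link between the operator and the formal one: on a tube all derivatives are termwise, and
    multiplication by $\varrho$ is [PS_incr_1]. *)
Lemma fps_sum_L_op D K g q rho : open D -> 0 < K -> geom_family D K g ->
  tube D K (q, rho) ->
  is_pseries (fun n => L_formal g n q) rho (L_op (fps_sum g) q rho).
Proof.
  intros HD HK Hg Hz.
  pose proof (open_tube D K HD) as HT.
  assert (Hd := geom_family_derive D K HD HK _ Hg).
  assert (Hdd := geom_family_derive D K HD HK _ Hd).
  assert (Hp := geom_family_pd D K p3 _ in_p3 Hg).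
  assert (Hpp := geom_family_pd D K p3 _ in_p3 Hp).
  assert (Hin : In (p3, p4) [(x3, x4); (y3, y4); (p3, p4)]) by (simpl; auto).
  assert (E1 : pd rho4 (fps_sum g) (q, rho) =
    PSeries (PS_derive (fun k => g k q)) rho)
    by now apply (fps_sum_pd_rho D K).
  assert (E2 : pd rho4 (pd rho4 (fps_sum g)) (q, rho) =
    PSeries (PS_derive (PS_derive (fun k => g k q))) rho).
  { rewrite (pd_ext_on rho4 (tube D K) _
      (fps_sum (fun k q => INR (S k) * g (S k) q))); auto.
    - now apply (fps_sum_pd_rho D K).
    - apply lawful_coords4, in_rho4.
    - intros z Hz'. now apply (fps_sum_pd_rho D K). }
  assert (E3 : pd p4 (pd p4 (fps_sum g)) (q, rho) =
    PSeries (fun k => dp 2 (g k) q) rho).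
  { rewrite (pd_ext_on p4 (tube D K) _ (fps_sum (fun k => pd p3 (g k)))); auto.
    - now apply (fps_sum_pd_space D K HD HK p3).
    - apply lawful_coords4, in_p4.
    - intros z Hz'. now apply (fps_sum_pd_space D K HD HK p3). }
  assert (S1 := PSeries_correct _ _ (geom_family_ex_pseries D K HK _ q rho Hd Hz)).
  assert (S2 := PSeries_correct _ _ (geom_family_ex_pseries D K HK _ q rho Hdd Hz)).
  assert (S3 := PSeries_correct _ _ (geom_family_ex_pseries D K HK _ q rho Hpp Hz)).
  apply is_pseries_incr_1 in S2.
  (* [is_pseries_scal] is stated over general rings and asks that the scalar commute with the
     variable. *)
  assert (C : forall a b : R, mult a b = mult b a) by (intros; apply Rmult_comm).
  apply (is_pseries_scal 2 _ _ _ (C _ _)) in S2.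
  apply (is_pseries_scal (- 3) _ _ _ (C _ _)) in S1.
  apply (is_pseries_scal (- (1 / 8)) _ _ _ (C _ _)) in S3.
  pose proof (is_pseries_plus _ _ _ _ _ (is_pseries_plus _ _ _ _ _ S2 S1) S3)
    as Hsum.
  unfold L_op. rewrite E1, E2, E3.
  match type of Hsum with is_pseries _ _ ?l => replace (_ - _) with l end.
  - apply is_pseries_ext with (2 := Hsum). intros n.
    unfold PS_plus, PS_scal, L_formal.
    change (2 * PS_incr_1 (PS_derive (PS_derive (fun k => g k q))) n
      + - 3 * PS_derive (fun k => g k q) n + - (1 / 8) * dp 2 (g n) q =
      2 * PS_incr_1 (PS_derive (PS_derive (fun k => g k q))) n
      - 3 * PS_derive (fun k => g k q) n - 1 / 8 * dp 2 (g n) q). ring.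
  - change (2 * (rho * PSeries (PS_derive (PS_derive (fun k => g k q))) rho)
      + - 3 * PSeries (PS_derive (fun k => g k q)) rho
      + - (1 / 8) * PSeries (fun k => dp 2 (g k) q) rho =
      2 * rho * PSeries (PS_derive (PS_derive (fun k => g k q))) rho
      - 3 * PSeries (PS_derive (fun k => g k q)) rho
      - 1 / 8 * PSeries (fun k => dp 2 (g k) q) rho). ring.
Qed.

Lemma is_pseries_fps_const s q rho :
  is_pseries (fun n => fps_const s n q) rho (s q).
Proof.
  apply is_pseries_R.
  pose proof (is_series_truncated (fun _ => s q) 0) as H. rewrite sum_O in H.
  apply is_series_ext with (2 := H). intros [|n]; simpl; ring.
Qed.

Lemma fps_sum_L_op_source D K g q rho l : open D -> 0 < K -> geom_family D K g ->
  tube D K (q, rho) -> is_pseries (fun n => L_formal g n q) rho l ->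
  L_op (fps_sum g) q rho = l.
Proof.
  intros HD HK Hg Hz Hl.
  rewrite <- (is_pseries_unique _ _ _ (fps_sum_L_op D K g q rho HD HK Hg Hz)).
  now apply is_pseries_unique.
Qed.

Lemma smooth_rho (W : R * R * R * R -> Prop) : smooth coords4 W (fun z => snd z).
Proof.
  intros [|n]; (split; [intros [q r] _; apply continuous_snd|]); [exact I|].
  intros c Hc.
  assert (Hcase : exists k, forall z,
    is_derive (fun t => snd (upd c z t)) (get c z) k).
  { destruct Hc as [<-|[<-|[<-|[<-|[]]]]];
      [exists 0|exists 0|exists 0|exists 1];
      intros [[[x y] p] r]; try exact (is_derive_const r _).
    exact (is_derive_id r). }
  destruct Hcase as [k Hk]. split.
  - intros z _. eexists. apply Hk.
  - replace (pd c _) with (fun _ : R * R * R * R => k); [apply Cn_const|].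
    apply functional_extensionality.
    intros z. symmetry. apply is_derive_unique, Hk.
Qed.

Ltac smooth4 := pose proof in_p4; pose proof in_rho4; pose proof lawful_coords4;
  repeat first [ assumption | apply smooth_rho | apply smooth_const
    | apply smooth_plus; [assumption|assumption| |]
    | apply smooth_mult; [assumption|assumption| |]
    | apply smooth_pd; [assumption|]].

Section Slices.
Variables (U : R * R * R -> Prop) (W : R * R * R * R -> Prop).
Hypotheses (HU : open U) (HW : open W) (HUW : forall q, U q -> W (q, 0)).

Lemma Cn_slice n G : Cn coords4 n W G -> Cn coords3 n U (fun q => G (q, 0)).
Proof.
  revert G. induction n as [|n IH]; intros G [H0 H1];
   (split; [intros q Hq; apply (continuous_comp (fun q => (q, 0)) G);
     [|now apply H0, HUW]; intros P [e He]; exists e; intros z Hz; apply He;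
     split; [exact Hz|apply ball_center]|]); [exact I|].
  intros c Hc.
  assert (H : exists c4, In c4 coords4 /\
    (forall q, ex_derive (fun t => G (upd c4 (q, 0) t)) (get c4 (q, 0)) ->
       ex_derive (fun t => G (upd c q t, 0)) (get c q)) /\
    forall q, pd c4 G (q, 0) = pd c (fun q => G (q, 0)) q).
  { destruct Hc as [<-|[<-|[<-|[]]]]; [exists x4|exists y4|exists p4];
      (split; [simpl; auto|]; split; intros [[x y] p]; [exact (fun H => H)|];
       reflexivity). }
  destruct H as [c4 [Hc4 [Hex Hpd]]]. destruct (H1 c4 Hc4) as [Hd HC]. split.
  - intros q Hq. now apply Hex, Hd, HUW.
  - replace (pd c (fun q => G (q, 0))) with (fun q : R * R * R => pd c4 G (q, 0));
      [now apply IH|].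
    now apply functional_extensionality.
Qed.

(** Schwarz's theorem; both mixed partial derivatives are continuous because [Cn] demands continuity
    of every iterated one. *)
Lemma pd_p4_rho4_comm G z : smooth coords4 W G -> W z ->
  pd p4 (pd rho4 G) z = pd rho4 (pd p4 G) z.
Proof.
  intros HG Hz. destruct z as [[[x y] p] rho].
  assert (Hcont : forall H, smooth coords4 W H -> continuity_2d_pt
    (fun u v => H (x, y, u, v)) p rho).
  { intros H HH. apply continuity_2d_pt_filterlim.
    apply (filterlim_comp _ _ _ (fun z : R * R => (x, y, fst z, snd z)) H _
      (locally (x, y, p, rho))).
    - intros P [e He]. exists e. intros [u v] [Hu Hv]. apply He.
      repeat split; try apply ball_center; assumption.
    - exact (smooth_continuous coords4 W H _ HH Hz). }
  apply (Schwarz (fun u v => G (x, y, u, v)) p rho).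
  - destruct (HW _ Hz) as [e He]. exists e. intros u v Hu Hv.
    assert (Hin : W (x, y, u, v)).
    { apply He. repeat split; try apply ball_center; assumption. }
    split; [|split; [|split]].
    + exact (smooth_ex_derive coords4 W G p4 (x, y, u, v) in_p4 HG Hin).
    + exact (smooth_ex_derive coords4 W G rho4 (x, y, u, v) in_rho4 HG Hin).
    + exact (smooth_ex_derive coords4 W (pd rho4 G) p4 (x, y, u, v) in_p4
        (smooth_pd _ _ _ _ in_rho4 HG) Hin).
    + exact (smooth_ex_derive coords4 W (pd p4 G) rho4 (x, y, u, v) in_rho4
        (smooth_pd _ _ _ _ in_p4 HG) Hin).
  - apply (Hcont (pd p4 (pd rho4 G))).
    apply smooth_pd; [exact in_p4|]. apply smooth_pd; [exact in_rho4|exact HG].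
  - apply (Hcont (pd rho4 (pd p4 G))).
    apply smooth_pd; [exact in_rho4|]. apply smooth_pd; [exact in_p4|exact HG].
Qed.

Definition drho (n : nat) (F : R * R * R * R -> R) := dw (repeat rho4 n) F.

Lemma incl_repeat_rho4 n : incl (repeat rho4 n) coords4.
Proof. intros c Hc. apply repeat_spec in Hc as ->. exact in_rho4. Qed.

Lemma smooth_drho n F : smooth coords4 W F -> smooth coords4 W (drho n F).
Proof. intros H. apply smooth_dw; auto. apply incl_repeat_rho4. Qed.

Lemma drho_S n F : drho n (pd rho4 F) = drho (S n) F.
Proof.
  unfold drho. change (repeat rho4 (S n)) with (rho4 :: repeat rho4 n).
  now rewrite repeat_cons, dw_app.
Qed.

Lemma drho_p4 n F z : smooth coords4 W F -> W z ->
  drho n (pd p4 F) z = pd p4 (drho n F) z.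
Proof.
  intros HF. revert z. induction n as [|n IH]; intros z Hz; [reflexivity|].
  change (pd rho4 (drho n (pd p4 F)) z = pd p4 (pd rho4 (drho n F)) z).
  rewrite (pd_ext_on rho4 W _ (pd p4 (drho n F))); auto.
  - symmetry. apply pd_p4_rho4_comm; [now apply smooth_drho|exact Hz].
  - apply lawful_coords4, in_rho4.
Qed.

Lemma drho_Derive_n n F q rho :
  drho n F (q, rho) = Derive_n (fun t => F (q, t)) n rho.
Proof.
  revert rho. induction n as [|n IH]; intros rho; [reflexivity|].
  change (pd rho4 (drho n F) (q, rho) =
    Derive (Derive_n (fun t => F (q, t)) n) rho).
  destruct q as [[x y] p]. apply Derive_ext. intros t. apply IH.
Qed.

(** Leibniz's rule, cut to two terms because the first factor is linear. At [n = 0] the value of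
    [pred n] is harmless, being multiplied by 0. *)
Lemma drho_rho_mult n G z : smooth coords4 W G -> W z ->
  drho n (fun z => snd z * G z) z =
    snd z * drho n G z + INR n * drho (pred n) G z.
Proof.
  intros HG. revert z. induction n as [|n IH]; intros z Hz.
  - unfold drho. simpl. ring.
  - change (drho (S n) (fun z => snd z * G z) z) with
      (pd rho4 (drho n (fun z => snd z * G z)) z).
    rewrite (pd_ext_on rho4 W _
      (fun z => snd z * drho n G z + INR n * drho (pred n) G z)); auto;
      [|apply lawful_coords4, in_rho4].
    assert (H1 := smooth_ex_derive coords4 W _ rho4 z in_rho4
      (smooth_drho n G HG) Hz).
    assert (H2 := smooth_ex_derive coords4 W _ rho4 z in_rho4
      (smooth_drho (pred n) G HG) Hz).
    assert (D1 : Derive (fun t => drho n G (upd rho4 z t)) (get rho4 z) =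
      drho (S n) G z) by reflexivity.
    assert (D2 : INR n * Derive (fun t => drho (pred n) G (upd rho4 z t))
      (get rho4 z) = INR n * drho n G z).
    { destruct n as [|n]; [simpl; ring|reflexivity]. }
    destruct z as [[[x y] p] rho]. cbn [pred] in *.
    unfold pd. cbn [upd get rho4 snd] in *.
    rewrite Derive_plus, Derive_mult, Derive_id, Derive_scal, D1, D2, S_INR.
    + cbn [snd]. ring.
    + apply ex_derive_id.
    + exact H1.
    + apply (ex_derive_mult (fun t => t) (fun t => drho n G (x, y, p, t)));
        [apply ex_derive_id|exact H1].
    + now apply ex_derive_scal.
Qed.

Definition taylor (F : R * R * R * R -> R) : fps := fun n q =>
  / INR (fact n) * drho n F (q, 0).

Lemma taylor_0 F q : taylor F 0%nat q = F (q, 0).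
Proof. unfold taylor, drho. simpl. field. Qed.

Lemma smooth_taylor F n : smooth coords4 W F -> smooth coords3 U (taylor F n).
Proof.
  intros HF. apply smooth_mult; [exact lawful_coords3|exact HU| |].
  - apply smooth_const.
  - intros m. apply (Cn_slice m (drho n F)). now apply smooth_drho.
Qed.

Lemma taylor_ext n F1 F2 q : (forall z, W z -> F1 z = F2 z) -> U q ->
  taylor F1 n q = taylor F2 n q.
Proof.
  intros H Hq. unfold taylor, drho.
  rewrite (dw_ext_on coords4 _ W F1 F2); auto.
  - exact lawful_coords4.
  - apply incl_repeat_rho4.
Qed.

Lemma taylor_plus n F1 F2 q : smooth coords4 W F1 -> smooth coords4 W F2 ->
  U q -> taylor (fun z => F1 z + F2 z) n q = taylor F1 n q + taylor F2 n q.
Proof.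
  intros H1 H2 Hq. unfold taylor, drho.
  rewrite (dw_plus coords4 _ W); auto; [ring|exact lawful_coords4|].
  apply incl_repeat_rho4.
Qed.

Lemma taylor_scal n k F q : taylor (fun z => k * F z) n q = k * taylor F n q.
Proof. unfold taylor, drho. rewrite dw_scal. ring. Qed.

Lemma taylor_const n s q : taylor (fun z => s (fst z)) n q = fps_const s n q.
Proof.
  unfold taylor. rewrite drho_Derive_n. cbn [fst].
  destruct n as [|n]; [simpl; field|].
  replace (Derive_n _ _ _) with 0; [simpl; ring|].
  symmetry. apply (Derive_n_const n (s q)).
Qed.

Lemma taylor_p4 n F q : smooth coords4 W F -> U q ->
  taylor (pd p4 F) n q = dp 1 (taylor F n) q.
Proof.
  intros HF Hq. unfold taylor. rewrite drho_p4 by auto.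
  rewrite (dp_scal 1 _ (fun q => drho n F (q, 0))). f_equal.
  now destruct q as [[x y] p].
Qed.

(** [L_op] as a function of one point, built only from sums, scalar multiples and products by
    $\varrho$, the operations for which [taylor] has rules. *)
Definition L4 (F : R * R * R * R -> R) (z : R * R * R * R) : R :=
  2 * (snd z * pd rho4 (pd rho4 F) z)
  + (- 3 * pd rho4 F z + - (1 / 8) * pd p4 (pd p4 F) z).

Lemma smooth_L4 F : smooth coords4 W F -> smooth coords4 W (L4 F).
Proof. intros HF. unfold L4. smooth4. Qed.

(** At $\varrho=0$ only the second term of Leibniz's rule remains, so $\varrho F_{\varrho\varrho}$
    contributes $n(n+1)$ times the next Taylor coefficient, as in [L_formal_rec]. *)
Lemma taylor_L4 n F q : smooth coords4 W F -> U q ->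
  taylor (L4 F) n q = L_formal (taylor F) n q.
Proof.
  intros HF Hq. rewrite L_formal_rec.
  assert (Hp : smooth coords4 W (pd p4 F)) by smooth4.
  assert (Epp : taylor (pd p4 (pd p4 F)) n q = dp 2 (taylor F n) q).
  { rewrite taylor_p4 by auto. change (dp 2 (taylor F n) q) with
      (dp 1 (dp 1 (taylor F n)) q).
    apply (dp_ext_on 1 U); auto. intros z Hz. now apply taylor_p4. }
  rewrite <- Epp.
  assert (ES : taylor (pd rho4 F) n q = (INR n + 1) * taylor F (S n) q).
  { unfold taylor. rewrite drho_S, fact_simpl, mult_INR, S_INR.
    pose proof (INR_fact_lt_0 n). pose proof (pos_INR n). field. lra. }
  assert (ER : taylor (fun z => snd z * pd rho4 (pd rho4 F) z) n q =
    INR n * (INR n + 1) * taylor F (S n) q).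
  { rewrite Rmult_assoc, <- ES. unfold taylor.
    rewrite drho_rho_mult by (auto; smooth4). cbn [snd].
    destruct n as [|n]; [simpl; ring|]. cbn [pred].
    rewrite (drho_S n (pd rho4 F)). ring. }
  unfold L4. rewrite taylor_plus, taylor_plus, !taylor_scal, ES, ER; auto;
    [ring|smooth4..].
Qed.

Lemma taylor_pseries F (a : fps) q :
  (forall q rho, W (q, rho) -> is_pseries (fun k => a k q) rho (F (q, rho))) ->
  U q -> forall n, a n q = taylor F n q.
Proof.
  intros Ha Hq n.
  assert (Hline : exists e : posreal, forall rho, Rabs rho < e ->
    is_pseries (fun k => a k q) rho (F (q, rho))).
  { destruct (HW _ (HUW q Hq)) as [e He]. exists e. intros rho Hrho.
    apply Ha, He. split; [apply ball_center|].
    change (Rabs (rho - 0) < e). now rewrite Rminus_0_r. }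
  destruct Hline as [e He].
  pose proof (cond_pos e) as Hpos.
  (* If the radius were below [e / 2], the terms at [e / 2] could not tend to 0, against convergence
     there. *)
  assert (Hrad : Rbar_lt 0 (CV_radius (fun k => a k q))).
  { apply Rbar_lt_le_trans with (e / 2); [simpl; lra|].
    apply Rbar_not_lt_le. intros Hlt.
    assert (Habs : Rabs (e / 2) = e / 2) by (apply Rabs_pos_eq; lra).
    apply (CV_disk_outside (fun k => a k q) (e / 2)); [now rewrite Habs|].
    apply ex_series_lim_0. eexists. apply is_pseries_R, He. lra. }
  unfold taylor. rewrite drho_Derive_n.
  rewrite (Derive_n_ext_loc _ (PSeries (fun k => a k q))).
  - rewrite Derive_n_coef by exact Hrad. pose proof (INR_fact_lt_0 n).
    field. lra.
  - exists e. intros rho Hrho. symmetry. apply is_pseries_unique, He.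
    change (Rabs (rho - 0) < e) in Hrho. now rewrite Rminus_0_r in Hrho.
Qed.

End Slices.

(** * Analytic solutions and the explicit series *)

Section Main.
Variables (U : R * R * R -> Prop) (V : R * R -> Prop)
  (f : R * R * R -> R) (h : R * R -> R).
Hypotheses (hU : open U)
  (hUV : forall x y p, U (x, y, p) -> V (x, y))
  (hf : smooth coords3 U f) (hh : smooth coords2 V h).

Lemma L4_L_op F q rho : L4 F (q, rho) = L_op F q rho.
Proof. unfold L4, L_op. cbn [snd]. ring. Qed.

Lemma taylor_formal_solution (W : R * R * R * R -> Prop)
    (A B C : R * R * R * R -> R) : open W -> (forall q, U q -> W (q, 0)) ->
  smooth coords4 W A -> smooth coords4 W B -> smooth coords4 W C ->
  (forall q, U q -> A (q, 0) = 0 /\ B (q, 0) = 0 /\ C (q, 0) = 0) ->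
  (forall q rho, W (q, rho) ->
     L_op A q rho = sourceA f q /\
     L_op B q rho = - (1 / 36) * pd p4 A (q, rho) + sourceB f h q /\
     L_op C q rho =
       - (1 / 18) * pd p4 B (q, rho) + 1 / 324 * A (q, rho)
       + sourceC f h q) ->
  formal_solution U f h (taylor A) (taylor B) (taylor C).
Proof.
  intros HW HUW HA HB HC H0 HL.
  assert (LA := smooth_L4 W HW A HA). assert (LB := smooth_L4 W HW B HB).
  assert (LC := smooth_L4 W HW C HC).
  split; [|split].
  - intros k. repeat split; now apply (smooth_taylor U W).
  - intros q Hq. rewrite !taylor_0. now apply H0.
  - intros n q Hq. rewrite <- !(taylor_L4 U W) by auto.
    rewrite <- (taylor_p4 U W HW HUW n A), <- (taylor_p4 U W HW HUW n B)
      by auto.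
    rewrite <- !taylor_const.
    assert (SA : smooth coords4 W (fun z => 1 / 36 * pd p4 A z)) by smooth4.
    assert (SB : smooth coords4 W (fun z => 1 / 18 * pd p4 B z)) by smooth4.
    assert (SA' : smooth coords4 W (fun z => - (1 / 324) * A z)) by smooth4.
    assert (SC : smooth coords4 W
      (fun z => 1 / 18 * pd p4 B z + - (1 / 324) * A z)) by smooth4.
    repeat split.
    + apply (taylor_ext U W); auto. intros [z rho] Hz. rewrite L4_L_op.
      now apply HL.
    (* The source is replaced on [W] by [L4 B] plus the transposed $A_p$ term, a sum of functions
       known to be smooth, so that [taylor_plus] can split it. *)
    + rewrite <- (taylor_ext U W HW HUW n (fun z => L4 B z + 1 / 36 * pd p4 A z)
        (fun z => sourceB f h (fst z))); auto.
      * rewrite (taylor_plus U W), taylor_scal; auto. ring.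
      * intros [z rho] Hz. rewrite L4_L_op. cbn [fst].
        destruct (HL z rho Hz) as [_ [-> _]]. ring.
    + rewrite <- (taylor_ext U W HW HUW n (fun z => L4 C z +
        (1 / 18 * pd p4 B z + - (1 / 324) * A z))
        (fun z => sourceC f h (fst z))); auto.
      * rewrite (taylor_plus U W), (taylor_plus U W), !taylor_scal; auto. ring.
      * intros [z rho] Hz. rewrite L4_L_op. cbn [fst].
        destruct (HL z rho Hz) as [_ [_ ->]]. ring.
Qed.

Lemma open_inter_cylinder (W : R * R * R * R -> Prop) : open W ->
  open (fun z => W z /\ U (fst z)).
Proof.
  intros HW. apply open_and; [exact HW|].
  apply (open_comp fst U); [intros [q r] _; apply continuous_fst|exact hU].
Qed.

Lemma analytic_solution_expansion A B C : analytic_solution U f h A B C ->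
  near_rho0 U (fun q rho =>
    is_pseries (fun k => solA f k q) rho (A (q, rho)) /\
    is_pseries (fun k => solB f h k q) rho (B (q, rho)) /\
    is_pseries (fun k => solC f h k q) rho (C (q, rho))).
Proof.
  intros [W [[HW HUW] [[HA [HB HC]] [[[a Ha] [[b Hb] [c Hc]]] [H0 HL]]]]].
  pose proof (taylor_formal_solution W A B C HW HUW HA HB HC H0 HL) as Hsol.
  rewrite (formal_solution_iff U V f h hU hUV hf hh) in Hsol.
  (* The coefficients are identified only over [U], so [W] is cut down to the cylinder above [U]. *)
  exists (fun z => W z /\ U (fst z)). split; [split|].
  - now apply open_inter_cylinder.
  - intros q Hq. split; [now apply HUW|exact Hq].
  - intros q rho [Hz Hq]. cbn [fst] in Hq.
    split; [|split].
    + apply is_pseries_ext with (2 := Ha q rho Hz). intros n.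
      rewrite (taylor_pseries U W HW HUW A a q Ha Hq). now apply Hsol.
    + apply is_pseries_ext with (2 := Hb q rho Hz). intros n.
      rewrite (taylor_pseries U W HW HUW B b q Hb Hq). now apply Hsol.
    + apply is_pseries_ext with (2 := Hc q rho Hz). intros n.
      rewrite (taylor_pseries U W HW HUW C c q Hc Hq). now apply Hsol.
Qed.

(** The union of all admissible tubes. No choice of [D] and [K] per base point is made, and openness
    is immediate. *)
Definition good_tube (z : R * R * R * R) : Prop :=
  exists DK, convergence_domain U f h (fst DK) (snd DK) /\ tube (fst DK) (snd DK) z.

Lemma open_good_tube : open good_tube.
Proof.
  intros z [[D K] [Hgood Hz]]. pose proof Hgood as [HD _].
  generalize (open_tube D K HD z Hz). apply filter_imp.
  intros z' Hz'. now exists (D, K).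
Qed.

Lemma nbhd_good_tube : analytic U f -> nbhd_rho0 U good_tube.
Proof.
  intros Hf. split; [exact open_good_tube|]. intros q Hq.
  destruct (exists_convergence_domain U V f h hU hUV hf hh q Hf Hq) as [D [K [Hgood Hq']]].
  exists (D, K). split; [exact Hgood|]. split; [exact Hq'|]. cbn [fst snd].
  rewrite Rabs_R0, Rmult_0_r. exact Rlt_0_1.
Qed.

Lemma sol_convergence : analytic U f ->
  near_rho0 U (fun q rho =>
    ex_pseries (fun k => solA f k q) rho /\
    ex_pseries (fun k => solB f h k q) rho /\
    ex_pseries (fun k => solC f h k q) rho).
Proof.
  intros Hf. exists good_tube. split; [now apply nbhd_good_tube|].
  intros q rho [[D K] [[HD [HK [HDU [HA [HB HC]]]]] Hz]].
  repeat split; now apply (geom_family_ex_pseries D K).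
Qed.

Lemma smooth_on_good_tubes (W0 : R * R * R * R -> Prop) F
    (g : fps) : open W0 ->
  (forall q rho, W0 (q, rho) -> is_pseries (fun k => g k q) rho (F (q, rho))) ->
  (forall D K, convergence_domain U f h D K -> geom_family D K g) ->
  smooth coords4 (fun z => W0 z /\ good_tube z) F.
Proof.
  intros HW0 HF Hg n.
  (* The pairs [DK] with their admissibility proof become the index set of a cover, as [Cn_union]
     requires. *)
  apply Cn_sub with (fun z => exists DK : {DK | convergence_domain U f h (fst DK) (snd DK)},
    W0 z /\ tube (fst (proj1_sig DK)) (snd (proj1_sig DK)) z).
  { intros z [Hz [DK [Hgood Ht]]]. now exists (exist _ DK Hgood). }
  apply (Cn_union coords4 n (fun DK : {DK | convergence_domain U f h (fst DK) (snd DK)} =>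
    fun z => W0 z /\ tube (fst (proj1_sig DK)) (snd (proj1_sig DK)) z)).
  intros [[D K] Hgood]. cbn [proj1_sig fst snd].
  pose proof (Hg D K Hgood) as Hfam. destruct Hgood as [HD [HK _]].
  apply Cn_ext with (fps_sum g).
  - exact lawful_coords4.
  - apply open_and; [exact HW0|now apply open_tube].
  - intros [q rho] [Hz _]. now apply is_pseries_unique, HF.
  - apply Cn_sub with (tube D K); [tauto|]. now apply Cn_fps_sum.
Qed.

Lemma expansion_analytic_solution A B C : analytic U f ->
  near_rho0 U (fun q rho =>
    is_pseries (fun k => solA f k q) rho (A (q, rho)) /\
    is_pseries (fun k => solB f h k q) rho (B (q, rho)) /\
    is_pseries (fun k => solC f h k q) rho (C (q, rho))) ->
  analytic_solution U f h A B C.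
Proof.
  intros Hf [W0 [[HW0 HUW0] HW]].
  assert (EA : forall q rho, W0 (q, rho) ->
    is_pseries (fun k => solA f k q) rho (A (q, rho))) by apply HW.
  assert (EB : forall q rho, W0 (q, rho) ->
    is_pseries (fun k => solB f h k q) rho (B (q, rho))) by apply HW.
  assert (EC : forall q rho, W0 (q, rho) ->
    is_pseries (fun k => solC f h k q) rho (C (q, rho))) by apply HW.
  exists (fun z => W0 z /\ good_tube z).
  split; [|split; [|split; [|split]]].
  - split; [apply open_and; [exact HW0|exact open_good_tube]|].
    intros q Hq. split; [now apply HUW0|now apply nbhd_good_tube].
  - repeat split; eapply smooth_on_good_tubes; eauto; intros D K Hgood;
      apply Hgood.
  - repeat split; [exists (solA f)|exists (solB f h)|exists (solC f h)];
      intros q rho [Hz _]; now apply HW.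
  - intros q Hq. specialize (HUW0 q Hq).
    rewrite <- (is_pseries_unique _ _ _ (EA _ _ HUW0)),
      <- (is_pseries_unique _ _ _ (EB _ _ HUW0)),
      <- (is_pseries_unique _ _ _ (EC _ _ HUW0)), !PSeries_0.
    repeat split.
    + rewrite solA_eq. unfold fpart. ring.
    + rewrite solB_eq. unfold fps_rho, fpart. ring.
    + rewrite solC_eq. unfold fps_rho, fpart. ring.
  (* Around the given point the functions coincide with [fps_sum] on the open set where [W0] meets
     one tube, so their derivatives can be computed termwise there. *)
  - intros q rho [Hz [[D K] [Hgood Ht]]]. cbn [fst snd] in *.
    destruct Hgood as [HD [HK [HDU [FA [FB FC]]]]].
    assert (HE : open (fun z => W0 z /\ tube D K z))
      by (apply open_and; [exact HW0|now apply open_tube]).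
    assert (XA : forall z, W0 z /\ tube D K z -> A z = fps_sum (solA f) z).
    { intros [q' r] [Hz' _]. symmetry. now apply is_pseries_unique, EA. }
    assert (XB : forall z, W0 z /\ tube D K z -> B z = fps_sum (solB f h) z).
    { intros [q' r] [Hz' _]. symmetry. now apply is_pseries_unique, EB. }
    assert (XC : forall z, W0 z /\ tube D K z -> C z = fps_sum (solC f h) z).
    { intros [q' r] [Hz' _]. symmetry. now apply is_pseries_unique, EC. }
    assert (Hin : In (p3, p4) [(x3, x4); (y3, y4); (p3, p4)])
      by (simpl; auto).
    assert (PP : forall F g, geom_family D K g ->
      (forall z, W0 z /\ tube D K z -> F z = fps_sum g z) ->
      is_pseries (fun k => dp 1 (g k) q) rho (pd p4 F (q, rho))).
    { intros F g Fg XF.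
      assert (E : pd p4 F (q, rho) = PSeries (fun k => dp 1 (g k) q) rho).
      { transitivity (pd p4 (fps_sum g) (q, rho)).
        - apply (pd_ext_on p4 (fun z => W0 z /\ tube D K z)); auto.
          apply lawful_coords4, in_p4.
        - now apply (fps_sum_pd_space D K HD HK p3). }
      rewrite E.
      apply PSeries_correct.
      exact (geom_family_ex_pseries D K HK _ q rho (geom_family_pd D K p3 g in_p3 Fg) Ht). }
    assert (Hq : U q) by (apply HDU, Ht).
    assert (Cm : forall a b : R, mult a b = mult b a)
      by (intros; apply Rmult_comm).
    rewrite (L_op_ext_on _ A (fps_sum (solA f)) q rho HE XA) by auto.
    rewrite (L_op_ext_on _ B (fps_sum (solB f h)) q rho HE XB) by auto.
    rewrite (L_op_ext_on _ C (fps_sum (solC f h)) q rho HE XC) by auto.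
    (* Each equation reduces to summing the coefficient recurrence: the right-hand side must be the
       sum of the series with terms [L_formal]. *)
    repeat split; (eapply fps_sum_L_op_source; [exact HD|exact HK| |exact Ht|]);
      auto.
    + apply is_pseries_ext with (2 := is_pseries_fps_const (sourceA f) q rho).
      intros n. symmetry. now apply solA_rec with U.
    + pose proof (is_pseries_scal (- (1 / 36)) _ _ _ (Cm _ _) (PP A _ FA XA))
        as S1.
      pose proof (is_pseries_plus _ _ _ _ _ S1
        (is_pseries_fps_const (sourceB f h) q rho)) as S2.
      apply is_pseries_ext with (2 := S2). intros n. symmetry.
      now apply solB_rec with U V.
    + pose proof (is_pseries_scal (- (1 / 18)) _ _ _ (Cm _ _) (PP B _ FB XB))
        as S1.
      pose proof (is_pseries_scal (1 / 324) _ _ _ (Cm _ _) (EA q rho Hz)) as S2.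
      pose proof (is_pseries_plus _ _ _ _ _
        (is_pseries_plus _ _ _ _ _ S1 S2)
        (is_pseries_fps_const (sourceC f h) q rho)) as S3.
      apply is_pseries_ext with (2 := S3). intros n. symmetry.
      now apply solC_rec with U V.
Qed.

End Main.

Theorem theorem3p2 (U : R * R * R -> Prop) (V : R * R -> Prop)
    (f : R * R * R -> R) (h : R * R -> R)
    (hU : open U) (hV : open V)
    (hUV : forall x y p, U (x, y, p) -> V (x, y))
    (hf : smooth coords3 U f) (hh : smooth coords2 V h) :
  (forall a b c : fps,
     formal_solution U f h a b c <->
     (forall k q, U q ->
        a k q = solA f k q /\ b k q = solB f h k q /\ c k q = solC f h k q))
  /\
  (analytic U f ->
     near_rho0 U (fun q rho =>
       ex_pseries (fun k => solA f k q) rho /\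
       ex_pseries (fun k => solB f h k q) rho /\
       ex_pseries (fun k => solC f h k q) rho)
     /\
     (forall A B C : R * R * R * R -> R,
        analytic_solution U f h A B C <->
        near_rho0 U (fun q rho =>
          is_pseries (fun k => solA f k q) rho (A (q, rho)) /\
          is_pseries (fun k => solB f h k q) rho (B (q, rho)) /\
          is_pseries (fun k => solC f h k q) rho (C (q, rho))))).
Proof.
  split.
  - intros a b c. now apply formal_solution_iff with V.
  - intros Hf. split; [now apply sol_convergence with V|].
    intros A B C. split.
    + now apply analytic_solution_expansion with V.
    + now apply expansion_analytic_solution with V.
Qed.
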